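(* Let $R$ be a nonzero $m\times m$ rational matrix function with no poles on $\mathbb{T}$ given by \[ R(z)=zC(I_n-zA)^{-1}\Gamma+R_0+\Gamma^*(zI_n-A^* )^{-1}C^*, \] with $A$ a stable $n\times n$ matrix, and assume $R(\zeta)\ge0$ for each $\zeta\in\mathbb{T}$. Let $\Phi\in\mathfrak{R}H^\infty_{r\times m}$ be an outer spectral factor of $R$, and put $\mathcal{X}_\Phi=\{x\in\mathbb{C}^n: W_{obs}x\in\operatorname{Im}T_\Phi^*\}$. Then $\mathcal{X}_\Phi$ is invariant under $A$, the space $\bigvee_{\nu\ge0}A^\nu\Gamma\mathbb{C}^m$ is contained in $\mathcal{X}_\Phi$, and there exists an $r\times n$ matrix $C_\Phi$ such that \[ \Phi(z)=\Phi(0)+zC_\Phi(I_n-zA)^{-1}\Gamma,\qquad W_{obs}x=T_\Phi^*W_{\Phi,obs}x\quad (x\in\mathcal{X}_\Phi), \] where $W_{\Phi,obs}=\operatorname{col}(C_\Phi A^j)_{j\ge0}$ is the observability operator of $\{C_\Phi,A\}$. Moreover, $C_\Phi|_{\mathcal{X}_\Phi}$ is uniquely determined by the second identity. Furthermore, with $Q_\Phi=\sum_{\nu\ge0}(A^\nu)^*C_\Phi^*C_\Phi A^\nu$ the observability Gramian of $\{C_\Phi,A\}$, \[ \Phi(0)^*C_\Phi x=Cx-\Gamma^*Q_\Phi Ax\quad(x\in\mathcal{X}_\Phi),\qquad \Phi(0)^*\Phi(0)=R_0-\Gamma^*Q_\Phi\Gamma. \] In particular, $R_0-\Gamma^*Q_\Phi\Gamma$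 is nonnegative.
   Context: $\mathbb{T}$ is the unit circle, $\mathbb{D}$ the open unit disc. A square matrix is stable if its eigenvalues lie in $\mathbb{D}$. $\mathfrak{R}H^\infty_{k\times l}$ is the set of $k\times l$ rational matrix functions with no poles in the closed unit disc. For a rational matrix function $\Omega$, $\Omega^*(z):=\Omega(1/\bar z)^*$. $\ell^2_+(\mathbb{C}^k)$ is the space of square summable $\mathbb{C}^k$-valued sequences indexed by $j\ge0$; for a $k\times l$ matrix function $\Omega\in L^\infty(\mathbb{T})$ with Fourier coefficients $\Omega_j$, $T_\Omega:\ell^2_+(\mathbb{C}^l)\to\ell^2_+(\mathbb{C}^k)$ is the block Toeplitz operator with $(i,j)$ block $\Omega_{i-j}$. $W_{obs}=\operatorname{col}(CA^j)_{j\ge0}:\mathbb{C}^n\to\ell^2_+(\mathbb{C}^m)$ is the observability operator of $\{C,A\}$. An outer spectral factor of $R$ is a $\Phi\in\mathfrak{R}H^\infty_{r\times m}$ (some $r\le m$) with $R(z)=\Phi^*(z)\Phi(z)$ and $T_\Phi$ having dense range in $\ell^2_+(\mathbb{C}^r)$. *)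

(* Defs.v *)
From HB Require Import structures.
From mathcomp Require Import all_boot all_order all_algebra.
From mathcomp Require Import all_classical all_reals all_analysis.
From mathcomp Require Import complex.
Set Implicit Arguments. Unset Strict Implicit. Unset Printing Implicit Defensive.
Import Order.TTheory GRing.Theory Num.Theory.
Import numFieldNormedType.Exports.
Local Open Scope classical_set_scope.
Local Open Scope ring_scope.

HB.instance Definition _ (R : realType) :=
  PseudoPointedMetric.copy R[i] (R[i] : numClosedFieldType).

Section Defs.
Variable R : realType.
Local Notation C := R[i].

Definition mxadj p q (M : 'M[C]_(p, q)) : 'M[C]_(q, p) := map_mx Num.conj M^T.

Definition stable n (A : 'M[C]_n) : Prop :=
  forall l : C, eigenvalue A l -> `|l| < 1.

Definition Rfun m n (Cm : 'M[C]_(m, n)) (A : 'M[C]_n) (G : 'M[C]_(n, m))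
  (R0 : 'M[C]_m) (z : C) : 'M[C]_m :=
  z *: (Cm *m invmx (1%:M - z *: A) *m G) + R0
  + mxadj G *m invmx (z%:M - mxadj A) *m mxadj Cm.

Definition Rfun_defined n (A : 'M[C]_n) (z : C) : Prop :=
  (1%:M - z *: A) \in unitmx /\ (z%:M - mxadj A) \in unitmx.

Definition psd m (M : 'M[C]_m) : Prop :=
  forall x : 'cV[C]_m, 0 <= (mxadj x *m M *m x) 0 0.

(** Phi is (the restriction to the closed unit disc of) a rational matrix
    function with no poles in the closed unit disc *)
Definition RHinf r m (Phi : C -> 'M[C]_(r, m)) : Prop :=
  exists (N : 'M[{poly C}]_(r, m)) (d : {poly C}),
    (forall z : C, `|z| <= 1 -> d.[z] != 0) /\
    (forall z : C, `|z| <= 1 -> Phi z = d.[z]^-1 *: map_mx (fun p => p.[z]) N).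

Definition expi (t : R) : C := Complex (cos t) (sin t).

Definition fourier r m (Om : C -> 'M[C]_(r, m)) (k : int) : 'M[C]_(r, m) :=
  \matrix_(i, j)
    let g t := Om (expi t) i j * expi (- (k%:~R * t)) in
    Complex ((2 * pi)^-1 * \int[lebesgue_measure]_(t in `[0, 2 * pi]) complex.Re (g t))
            ((2 * pi)^-1 * \int[lebesgue_measure]_(t in `[0, 2 * pi]) complex.Im (g t)).

Definition sqn k (v : 'cV[C]_k) : C := \sum_i `|v i 0| ^+ 2.

Definition l2 k (u : nat -> 'cV[C]_k) : Prop := cvgn (series (fun j => sqn (u j))).

Definition inner k (u v : nat -> 'cV[C]_k) : C :=
  limn (series (fun j => (mxadj (v j) *m u j) 0 0)).

Definition toep r m (Om : C -> 'M[C]_(r, m)) (u : nat -> 'cV[C]_m) :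
  nat -> 'cV[C]_r :=
  fun i => \col_a limn (series (fun j => (fourier Om (i%:Z - j%:Z) *m u j) a 0)).

Definition toep_adj_eq r m (Om : C -> 'M[C]_(r, m)) (v : nat -> 'cV[C]_r)
  (y : nat -> 'cV[C]_m) : Prop :=
  l2 v /\ l2 y /\ forall u, l2 u -> inner (toep Om u) v = inner u y.

Definition in_range_toep_adj r m (Om : C -> 'M[C]_(r, m)) (y : nat -> 'cV[C]_m) :=
  exists v, toep_adj_eq Om v y.

Definition dense_range_toep r m (Om : C -> 'M[C]_(r, m)) : Prop :=
  forall v : nat -> 'cV[C]_r, l2 v -> forall e : C, 0 < e ->
    exists u, l2 u /\ inner (fun j => toep Om u j - v j) (fun j => toep Om u j - v j) < e.

Definition Wobs p n (Cm : 'M[C]_(p, n)) (A : 'M[C]_n) (x : 'cV[C]_n) :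
  nat -> 'cV[C]_p := fun j => Cm *m A ^+ j *m x.

Definition outer_spectral_factor m n r (Cm : 'M[C]_(m, n)) (A : 'M[C]_n)
  (G : 'M[C]_(n, m)) (R0 : 'M[C]_m) (Phi : C -> 'M[C]_(r, m)) : Prop :=
  [/\ (r <= m)%N, RHinf Phi,
      (forall z : C, `|z| = 1 -> Rfun Cm A G R0 z = mxadj (Phi z) *m Phi z)
    & dense_range_toep Phi].

Definition XPhi m n r (Cm : 'M[C]_(m, n)) (A : 'M[C]_n) (Phi : C -> 'M[C]_(r, m))
  (x : 'cV[C]_n) : Prop :=
  in_range_toep_adj Phi (Wobs Cm A x).

Definition krylov n m (A : 'M[C]_n) (G : 'M[C]_(n, m)) (x : 'cV[C]_n) : Prop :=
  exists (N : nat) (ys : 'I_N -> 'cV[C]_m), x = \sum_(k < N) A ^+ k *m G *m ys k.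

Definition mxsum p q (f : nat -> 'M[C]_(p, q)) : 'M[C]_(p, q) :=
  \matrix_(i, j) limn (series (fun k => f k i j)).

Definition gramian p n (Cm : 'M[C]_(p, n)) (A : 'M[C]_n) : 'M[C]_n :=
  mxsum (fun nu => mxadj (A ^+ nu) *m mxadj Cm *m Cm *m A ^+ nu).

End Defs.

(* Main.v *)
Require Import Defs.
From HB Require Import structures.
From mathcomp Require Import all_boot all_order all_algebra.
From mathcomp Require Import all_classical all_reals all_analysis.
From mathcomp Require Import complex.
From mathcomp Require Import ring lra zify.
Import Order.TTheory GRing.Theory Num.Theory.
Import numFieldNormedType.Exports.
Local Open Scope classical_set_scope.
Local Open Scope ring_scope.
Set Implicit Arguments.
Unset Strict Implicit.
Unset Printing Implicit Defensive.

                                                                          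
                                                                                
                                                                              
                                                                                
                                                                           
                                                                                
                                                                                 
                            

                                                                                   
                                                                            
                                                                           
                                                                              
                                                                                  
                                                                                  
                                  

(** Since [Phi] is rational without poles in the closed disc, it is a power series whose
    coefficients P_k decay geometrically, and T_Phi is the lower triangular block Toeplitz operator
    built from them. Comparing Fourier coefficients in R = Phi^* Phi on the circle
    ([spectral_factor_coef]) gives sum_k P_k^* P_{k+j} = R_j, where R_j = C A^{j-1} Gamma for j > 0
    and R_0 is the constant term.

    The rest is about the relation [adjeq v y], saying that the adjoint of T_Phi sends v to y. Three
    facts carry the proof. T_Phi commutes with the forward shift, so its adjoint commutes with the
    backward shift ([adjeq_shift]); as W_obs A x is the backward shift of W_obs x, the space X_Phi
    is invariant under A. The coefficient identities for j > 0 say that the adjoint sends the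
    sequence P_{i+1} e to W_obs Gamma e ([adjeq_Gamma]); so X_Phi contains the image of Gamma and,
    by invariance, the whole Krylov space. Dense range of T_Phi makes the adjoint injective
    ([adjeq_inj]), so the preimage v of W_obs x is determined by x and depends linearly on it. Any
    matrix C_Phi extending the map from x to v_0 then satisfies v_j = C_Phi A^j x, by shifting j
    times ([observation_matrix]).

    For x = Gamma e this reads P_{k+1} = C_Phi A^k Gamma, which is the realization of [Phi]. Entry 0
    of the adjoint identity is sum_i P_i^* C_Phi A^i x = C x; inserting the formula for P_i with i >
    0 turns the tail into Gamma^* Q A x ([gramian_obs]). The same substitution in the coefficient
    identity for j = 0 gives P_0^* P_0 = R_0 - Gamma^* Q Gamma ([gramian_Phi0]), and a Gram matrix
    is nonnegative.

    The analytic groundwork keeps an explicit geometric rate wherever it can: closure properties of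
    [geo] then replace complex function theory and most exchanges of limits. *)

(** * Real sequences dominated by a geometric sequence *)

Section GeometricDecay.
Variable R : realType.
Implicit Types (a b : nat -> R).

                                            
(** The bound is one-sided because it is applied to norms. The ratio is strictly positive so that it
    can be divided by when a shift is undone. *)
Definition geo a : Prop :=
  exists K rho : R, [/\ 0 <= K, 0 < rho < 1 & forall k, a k <= K * rho ^+ k].

Lemma geo_le a b : (forall k, a k <= b k) -> geo b -> geo a.
Proof.
move=> ab [K [rho [K0 r01 bK]]]; exists K, rho; split=> // k.
exact: le_trans (ab k) (bK k).
Qed.

Lemma geo_common a b : geo a -> geo b ->
  exists K rho : R, [/\ 0 <= K, 0 < rho < 1,
    forall k, a k <= K * rho ^+ k & forall k, b k <= K * rho ^+ k].
Proof.
move=> [K [s [K0 /andP[s0 s1] aK]]] [L [t [L0 /andP[t0 t1] bL]]].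
have m0 : 0 <= Num.max s t by rewrite le_max (ltW s0).
exists (K + L), (Num.max s t); split; first exact: addr_ge0.
- by rewrite lt_max s0 gt_max s1 t1.
- move=> k; apply: (le_trans (aK k)); apply: ler_pM => //.
  + by rewrite exprn_ge0 // ltW.
  + by rewrite lerDl.
  + by rewrite lerXn2r ?nnegrE ?(ltW s0) // le_max lexx.
- move=> k; apply: (le_trans (bL k)); apply: ler_pM => //.
  + by rewrite exprn_ge0 // ltW.
  + by rewrite lerDr.
  + by rewrite lerXn2r ?nnegrE ?(ltW t0) // le_max lexx orbT.
Qed.

Lemma geoD a b : geo a -> geo b -> geo (fun k => a k + b k).
Proof.
move=> ga gb; have [K [rho [K0 r01 aK bK]]] := geo_common ga gb.
exists (K + K), rho; split=> //; first exact: addr_ge0.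
by move=> k; rewrite mulrDl lerD.
Qed.

Lemma geoZ c a : 0 <= c -> geo a -> geo (fun k => c * a k).
Proof.
move=> c0 [K [rho [K0 r01 aK]]]; exists (c * K), rho; split=> //.
  exact: mulr_ge0.
by move=> k; rewrite -mulrA ler_wpM2l.
Qed.

Lemma geoZr c a : 0 <= c -> geo a -> geo (fun k => a k * c).
Proof. by move=> c0 /(geoZ c0); apply: geo_le => k; rewrite mulrC. Qed.

Lemma geo0 : geo (fun=> 0).
Proof.
exists 0, 2^-1; split=> [||k]; rewrite ?mul0r //.
by apply/andP; split; lra.
Qed.

Lemma geo_sum (I : Type) (s : seq I) (F : I -> nat -> R) :
  (forall i, geo (F i)) -> geo (fun k => \sum_(i <- s) F i k).
Proof.
move=> gF; elim: s => [|i s IH].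
  by apply: geo_le geo0 => k; rewrite big_nil.
by apply: geo_le (geoD (gF i) IH) => k; rewrite big_cons.
Qed.

Lemma geoS a : geo a -> geo (fun k => a k.+1).
Proof.
move=> [K [rho [K0 /andP[r0 r1] aK]]]; exists (K * rho), rho; split.
- by rewrite mulr_ge0 // ltW.
- by rewrite r0.
- by move=> k; rewrite -mulrA -exprS.
Qed.

Lemma geo_unshift a : geo (fun k => a k.+1) -> geo a.
Proof.
move=> [K [rho [K0 /andP[r0 r1] aK]]].
exists (`|a 0| + K / rho), rho; split.
- by rewrite addr_ge0 // divr_ge0 // ltW.
- by rewrite r0.
- case=> [|k].
    by rewrite expr0 mulr1 (le_trans (ler_norm _)) // lerDl divr_ge0 // ltW.
  apply: (le_trans (aK k)); rewrite mulrDl.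
  have -> : K / rho * rho ^+ k.+1 = K * rho ^+ k.
    by rewrite exprS mulrA divfK ?gt_eqF.
  by rewrite lerDr mulr_ge0 ?exprn_ge0 // ltW.
Qed.

Lemma geo_shift a n : geo a -> geo (fun k => a (k + n)%N).
Proof.
elim: n => [|n IH] ga; first by apply: geo_le ga => k; rewrite addn0.
by apply: geo_le (geoS (IH ga)) => k; rewrite addSnnS.
Qed.

Lemma geo_bounded a : geo a -> exists2 M, 0 <= M & forall k, a k <= M.
Proof.
move=> [K [rho [K0 /andP[r0 r1] aK]]]; exists K => // k.
by apply: (le_trans (aK k)); rewrite ler_piMr // exprn_ile1 // ltW.
Qed.

(** Choose a ratio s < 1 above l and at least the ratio of [b]. With L = K / (s - l), the bound
    ([|a 0|] + L) s^k propagates by induction, because l L + K = s L. This is the engine behind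
    division of power series and decay of matrix powers. *)
Lemma geo_rec l a b : 0 <= l < 1 -> geo b ->
  (forall k, a k.+1 <= l * a k + b k) -> geo a.
Proof.
move=> /andP[l0 l1] [K [rho [K0 /andP[r0 r1] bK]]] rec.
have [s [ls rs s1]] : exists s, [/\ l < s, rho <= s & s < 1].
  exists (Num.max ((1 + l) / 2) rho); split.
  - by rewrite lt_max; apply/orP; left; lra.
  - by rewrite le_max lexx orbT.
  - by rewrite gt_max r1 andbT; lra.
have s0 : 0 < s by apply: lt_le_trans rs.
have sl : 0 < s - l by rewrite subr_gt0.
exists (`|a 0| + K / (s - l)), s; split.
- by rewrite addr_ge0 // divr_ge0 // ltW.
- by rewrite s0.
elim=> [|k IH].
  by rewrite expr0 mulr1 (le_trans (ler_norm _)) // lerDl divr_ge0 // ltW.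
apply: (le_trans (rec k)).
apply: (@le_trans _ _ (l * ((`|a 0| + K / (s - l)) * s ^+ k) + K * s ^+ k)).
  apply: lerD; first by rewrite ler_wpM2l.
  apply: (le_trans (bK k)); rewrite ler_wpM2l //.
  by rewrite lerXn2r ?nnegrE ?(ltW r0) ?(ltW s0).
rewrite mulrA -mulrDl exprS mulrA ler_wpM2r ?exprn_ge0 ?(ltW s0) //.
have -> : K = (K / (s - l)) * (s - l) by rewrite divfK ?gt_eqF.
rewrite mulfK ?gt_eqF // -subr_ge0.
set L := K / (s - l).
have -> : (`|a 0| + L) * s - (l * (`|a 0| + L) + L * (s - l)) =
  `|a 0| * (s - l) by ring.
by rewrite mulr_ge0 // ltW.
Qed.

(** The sequence k rho^k obeys the recursion of [geo_rec] with l = rho and forcing term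
    rho^{k+1}. *)
Lemma geo_natmul a : geo a -> geo (fun k => k%:R * a k).
Proof.
move=> [K [rho [K0 /andP[r0 r1] aK]]].
suff g : geo (fun k => K * (k%:R * rho ^+ k)).
  apply: geo_le g => k.
  by rewrite [leRHS]mulrCA ler_wpM2l.
apply: geoZ => //; apply: (@geo_rec rho _ (fun k => rho * rho ^+ k)).
- by rewrite ltW.
- by exists rho, rho; split; rewrite ?r0 ?ltW.
- move=> k; rewrite exprS -natr1.
  by rewrite le_eqVlt; apply/orP; left; apply/eqP; ring.
Qed.

Lemma geo_lt a e : geo a -> 0 < e -> exists N, forall k, (N <= k)%N -> a k < e.
Proof.
move=> [K [rho [K0 /andP[r0 r1] aK]]] e0.
have r1' : `|rho| < 1 by rewrite gtr0_norm.
have /cvgrPdist_lt /(_ _ e0)[N _ HN] := @cvg_geometric R (K + 1) rho r1'.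
exists N => k Nk; have := HN k Nk; rewrite /= sub0r normrN.
rewrite ger0_norm; last by rewrite mulr_ge0 ?exprn_ge0 ?addr_ge0 // ltW.
apply: le_lt_trans; apply: (le_trans (aK k)).
by rewrite ler_wpM2r ?lerDl // exprn_ge0 // ltW.
Qed.

Lemma geo_const_le0 c : geo (fun=> c) -> c <= 0.
Proof.
move=> g; rewrite leNgt; apply/negP => c0.
by have [N /(_ N (leqnn N))] := geo_lt g c0; rewrite ltxx.
Qed.

Lemma geo_eventually a b N : (forall k, (N <= k)%N -> a k <= b k) ->
  geo b -> geo a.
Proof.
move=> ab gb; suff g : geo (fun k => a (k + N)%N).
  elim: N {ab} g => [|N IH] g; first by apply: geo_le g => k; rewrite addn0.
  by apply/IH/geo_unshift; apply: geo_le g => k; rewrite addSnnS.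
by apply: geo_le (geo_shift N gb) => k; apply: ab; rewrite leq_addl.
Qed.

End GeometricDecay.

(** * Convergence of complex sequences and series, with geometric rate *)

Section ComplexSequences.
Variable R : realType.
Local Notation C := R[i].
Implicit Types (x y z : C) (s t : nat -> C).

(** The modulus as an element of [R]: the norm of [R[i]] takes its values in [R[i]], where the order
    is only partial. *)
Definition nrm z : R := ComplexField.Normc.normc z.

Lemma nrmE z : `|z| = (nrm z)%:C%C.
Proof. by []. Qed.

Lemma nrm_ge0 z : 0 <= nrm z.
Proof. by rewrite -lecR -nrmE normr_ge0. Qed.

Lemma nrm0 : nrm 0 = 0.
Proof. by apply: complexI; rewrite -nrmE normr0. Qed.

Lemma nrm1 : nrm 1 = 1.
Proof. by apply: complexI; rewrite -nrmE normr1. Qed.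

Lemma nrm_eq0 z : nrm z = 0 -> z = 0.
Proof. by move=> z0; apply/eqP; rewrite -normr_eq0 nrmE z0. Qed.

Lemma nrmD x y : nrm (x + y) <= nrm x + nrm y.
Proof. by rewrite -lecR rmorphD /= -!nrmE ler_normD. Qed.

Lemma nrmN x : nrm (- x) = nrm x.
Proof. by apply: complexI; rewrite -!nrmE normrN. Qed.

Lemma nrmM x y : nrm (x * y) = nrm x * nrm y.
Proof. by apply: complexI; rewrite rmorphM /= -!nrmE normrM. Qed.

Lemma nrmX x k : nrm (x ^+ k) = nrm x ^+ k.
Proof. by apply: complexI; rewrite rmorphXn /= -!nrmE normrX. Qed.

Lemma nrmV x : nrm x^-1 = (nrm x)^-1.
Proof. by apply: complexI; rewrite fmorphV /= -!nrmE normfV. Qed.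

Lemma nrm_conj x : nrm (Num.conj x) = nrm x.
Proof. by apply: complexI; rewrite -!nrmE norm_conjC. Qed.

Lemma nrm_le1 x : (nrm x <= 1) = (`|x| <= 1).
Proof. by rewrite nrmE -(lecR (nrm x) 1). Qed.

Lemma nrm_sum (I : Type) (l : seq I) (P : pred I) (F : I -> C) :
  nrm (\sum_(i <- l | P i) F i) <= \sum_(i <- l | P i) nrm (F i).
Proof.
elim/big_ind2: _ => // [|x a y b xa yb]; first by rewrite nrm0.
exact: le_trans (nrmD _ _) (lerD xa yb).
Qed.

Lemma nrm_dist x y : nrm (x - y) = nrm (y - x).
Proof. by rewrite -nrmN opprB. Qed.

Lemma nrm_sqr z : nrm z ^+ 2 = complex.Re z ^+ 2 + complex.Im z ^+ 2.
Proof. by case: z => a b; rewrite sqr_sqrtr // addr_ge0 ?sqr_ge0. Qed.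

Lemma Re_le_nrm z : `|complex.Re z| <= nrm z.
Proof.
rewrite -(@ler_pXn2r _ 2) ?nnegrE ?nrm_ge0 // nrm_sqr.
by rewrite -normrX ger0_norm ?sqr_ge0 // lerDl sqr_ge0.
Qed.

Lemma Im_le_nrm z : `|complex.Im z| <= nrm z.
Proof.
rewrite -(@ler_pXn2r _ 2) ?nnegrE ?nrm_ge0 // nrm_sqr.
by rewrite -normrX ger0_norm ?sqr_ge0 // lerDr sqr_ge0.
Qed.

Lemma nrm_le_ReIm z : nrm z <= `|complex.Re z| + `|complex.Im z|.
Proof.
rewrite -(@ler_pXn2r _ 2) ?nnegrE ?nrm_ge0 ?addr_ge0 // nrm_sqr.
rewrite sqrrD -!normrX !(ger0_norm (sqr_ge0 _)) -addrA lerD2l lerDr.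
by rewrite mulrn_wge0 // mulr_ge0.
Qed.

Lemma cReD x y : complex.Re (x + y) = complex.Re x + complex.Re y.
Proof. by case: x; case: y. Qed.

Lemma cImD x y : complex.Im (x + y) = complex.Im x + complex.Im y.
Proof. by case: x; case: y. Qed.

Lemma cReN x : complex.Re (- x) = - complex.Re x.
Proof. by case: x. Qed.

Lemma cImN x : complex.Im (- x) = - complex.Im x.
Proof. by case: x. Qed.

Lemma cRe_sum (I : Type) (l : seq I) (P : pred I) (F : I -> C) :
  complex.Re (\sum_(i <- l | P i) F i) = \sum_(i <- l | P i) complex.Re (F i).
Proof. by apply: (big_morph (@complex.Re R) cReD). Qed.

Lemma cIm_sum (I : Type) (l : seq I) (P : pred I) (F : I -> C) :
  complex.Im (\sum_(i <- l | P i) F i) = \sum_(i <- l | P i) complex.Im (F i).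
Proof. by apply: (big_morph (@complex.Im R) cImD). Qed.

Lemma cvgCP s z : (s @ \oo --> z) <->
  forall e : R, 0 < e -> exists N, forall k, (N <= k)%N -> nrm (z - s k) < e.
Proof.
split=> [sz e e0|sz].
  have [|N _ HN] := (@cvgrPdist_lt (C : numFieldType) (C : numFieldType)
    _ _ _ s z).1 sz e%:C%C; first by rewrite (ltcR 0 e).
  by exists N => k Nk; rewrite -ltcR -nrmE; exact: HN.
apply: (@cvgrPdist_lt (C : numFieldType) (C : numFieldType) _ _ _ s z).2.
move=> e e0.
have /complex_realP[r er] : e \is Num.real by rewrite realE ltW.
have r0 : 0 < r by rewrite -ltcR -er.
have [N HN] := sz r r0.
by exists N => // k Nk; rewrite er nrmE ltcR; exact: HN.
Qed.

Lemma cvgC_unique s y z : (s @ \oo --> y) -> (s @ \oo --> z) -> y = z.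
Proof.
move=> /cvgCP sy /cvgCP sz; apply/eqP; rewrite -subr_eq0; apply/eqP.
apply: nrm_eq0; apply/eqP; rewrite eq_le nrm_ge0 andbT.
apply/ler_addgt0Pr => e e0; rewrite add0r.
have e2 : 0 < e / 2 by rewrite divr_gt0.
have [N HN] := sy _ e2; have [M HM] := sz _ e2.
have -> : y - z = (y - s (maxn N M)) - (z - s (maxn N M)) by ring.
apply: le_trans (nrmD _ _) _; rewrite nrmN [leRHS]splitr.
by rewrite lerD // ltW; [|exact: HN (leq_maxl _ _)| |exact: HM (leq_maxr _ _)].
Qed.

Lemma cvgC_lim s z : (s @ \oo --> z) -> limn s = z.
Proof. by move=> sz; apply: (cvgC_unique _ sz); apply: (cvgP z). Qed.

Lemma cvgC_lincomb c s t y z : (s @ \oo --> y) -> (t @ \oo --> z) ->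
  ((fun k => c * s k + t k) @ \oo --> c * y + z).
Proof.
move=> /cvgCP sy /cvgCP tz; apply/cvgCP => e e0.
have c1 : 0 < nrm c + 1 by rewrite ltr_wpDl ?nrm_ge0.
have e1 : 0 < e / 2 / (nrm c + 1) by rewrite !divr_gt0.
have e2 : 0 < e / 2 by rewrite divr_gt0.
have [N HN] := sy _ e1; have [M HM] := tz _ e2.
exists (maxn N M) => k; rewrite geq_max => /andP[Nk Mk].
have -> : c * y + z - (c * s k + t k) = c * (y - s k) + (z - t k) by ring.
apply: le_lt_trans (nrmD _ _) _; rewrite [ltRHS]splitr.
apply: ler_ltD; last exact: HM.
rewrite nrmM; apply: (@le_trans _ _ ((nrm c + 1) * nrm (y - s k))).
  by rewrite ler_wpM2r ?nrm_ge0 // lerDl.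
by rewrite mulrC -ler_pdivlMr //; apply: ltW; exact: HN.
Qed.

Lemma eq_cvgC s t z : s =1 t -> (s @ \oo --> z) -> (t @ \oo --> z).
Proof. by move=> /funext ->. Qed.

Lemma cvgC_cst z : ((fun=> z) @ \oo --> z).
Proof. by apply/cvgCP => e e0; exists 0%N => k _; rewrite subrr nrm0. Qed.

Lemma cvgCD s t y z : (s @ \oo --> y) -> (t @ \oo --> z) ->
  ((fun k => s k + t k) @ \oo --> y + z).
Proof.
move=> sy tz; have := cvgC_lincomb (c := 1) sy tz.
by rewrite mul1r; apply: eq_cvgC => k; rewrite mul1r.
Qed.

Lemma cvgCS s z : ((fun k => s k.+1) @ \oo --> z) <-> (s @ \oo --> z).
Proof.
split=> /cvgCP sz; apply/cvgCP => e e0; have [N HN] := sz e e0.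
  by exists N.+1; case=> // k Nk; exact: HN.
by exists N => k Nk; apply: HN; exact: leqW.
Qed.

Lemma cvgC_Re s z : (s @ \oo --> z) ->
  ((fun k => complex.Re (s k)) @ \oo --> complex.Re z).
Proof.
move=> /cvgCP sz; apply/(cvgrPdist_lt _ _).2 => e e0.
have [N HN] := sz e e0; exists N => // k Nk.
by apply: le_lt_trans (HN k Nk); rewrite -cReN -cReD Re_le_nrm.
Qed.

Lemma cvgC_ReIm s z :
  ((fun k => complex.Re (s k)) @ \oo --> complex.Re z) ->
  ((fun k => complex.Im (s k)) @ \oo --> complex.Im z) ->
  (s @ \oo --> z).
Proof.
move=> /(cvgrPdist_lt _ _).1 sr /(cvgrPdist_lt _ _).1 si; apply/cvgCP => e e0.
have e2 : 0 < e / 2 by rewrite divr_gt0.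
have [N _ HN] := sr _ e2; have [M _ HM] := si _ e2.
exists (maxn N M) => k; rewrite geq_max => /andP[Nk Mk].
apply: le_lt_trans (nrm_le_ReIm _) _; rewrite cReD cImD cReN cImN.
by rewrite [e]splitr ltrD //; [exact: HN|exact: HM].
Qed.

Lemma abs_series_cvgC s : (exists M, forall N, \sum_(k < N) nrm (s k) <= M) ->
  exists z, (series s @ \oo --> z).
Proof.
move=> [M sM].
have aux (f : nat -> R) : (forall k, `|f k| <= nrm (s k)) -> cvgn (series f).
  move=> fs; apply: normed_cvg; apply: nondecreasing_is_cvgn.
    by apply: nondecreasing_series => k _ _; exact: normr_ge0.
  exists M => _ [N _ <-]; apply: le_trans (sM N); rewrite /= /series /= big_mkord.
  exact: ler_sum.
have cr := aux (fun k => complex.Re (s k)) (fun k => Re_le_nrm (s k)).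
have ci := aux (fun k => complex.Im (s k)) (fun k => Im_le_nrm (s k)).
eexists (Complex _ _); apply: cvgC_ReIm => /=.
- by rewrite (_ : (fun k => _) = series (fun k => complex.Re (s k)));
    [exact: cr|apply/funext => k; rewrite /series /= cRe_sum].
- by rewrite (_ : (fun k => _) = series (fun k => complex.Im (s k)));
    [exact: ci|apply/funext => k; rewrite /series /= cIm_sum].
Qed.

(** Convergence with a geometric rate: stable under the finite algebraic operations below, and
    strong enough to give uniqueness of limits at once. *)
Definition gcvg s z : Prop := geo (fun k => nrm (s k - z)).

Lemma gcvg_cvg s z : gcvg s z -> (s @ \oo --> z).
Proof.
move=> g; apply/cvgCP => e e0; have [N HN] := geo_lt g e0.
by exists N => k Nk; rewrite nrm_dist; exact: HN.
Qed.

Lemma gcvg_unique s y z : gcvg s y -> gcvg s z -> y = z.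
Proof. by move=> /gcvg_cvg sy /gcvg_cvg; exact: cvgC_unique. Qed.

Lemma eq_gcvg s t z : s =1 t -> gcvg s z -> gcvg t z.
Proof. by move=> st; apply: geo_le => k; rewrite st. Qed.

Lemma gcvg_cst z : gcvg (fun=> z) z.
Proof. by apply: geo_le (geo0 R) => k; rewrite subrr nrm0. Qed.

Lemma gcvg_eventually N s z : (forall k, (N <= k)%N -> s k = z) -> gcvg s z.
Proof.
move=> sz; apply: (@geo_eventually _ _ (fun=> 0) N); last exact: geo0.
by move=> k Nk; rewrite sz // subrr nrm0.
Qed.

Lemma gcvgD s t y z : gcvg s y -> gcvg t z -> gcvg (fun k => s k + t k) (y + z).
Proof.
move=> sy tz; apply: geo_le (geoD sy tz) => k.
by rewrite opprD addrACA nrmD.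
Qed.

Lemma gcvgZ c s z : gcvg s z -> gcvg (fun k => c * s k) (c * z).
Proof.
move=> sz; apply: geo_le (geoZ (nrm_ge0 c) sz) => k.
by rewrite -mulrBr nrmM.
Qed.

Lemma gcvg_sum (I : Type) (l : seq I) (F : I -> nat -> C) (z : I -> C) :
  (forall i, gcvg (F i) (z i)) ->
  gcvg (fun k => \sum_(i <- l) F i k) (\sum_(i <- l) z i).
Proof.
move=> Fz; apply: geo_le (geo_sum l Fz) => k.
by rewrite -sumrB nrm_sum.
Qed.

Lemma gcvg_conj s z : gcvg s z -> gcvg (fun k => Num.conj (s k)) (Num.conj z).
Proof. by apply: geo_le => k; rewrite -rmorphB nrm_conj. Qed.

Lemma gcvgS s z : gcvg s z -> gcvg (fun k => s k.+1) z.
Proof. exact: geoS. Qed.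

Lemma gcvg_unshift s z : gcvg (fun k => s k.+1) z -> gcvg s z.
Proof. exact: geo_unshift. Qed.

(** Writing c = L (1 - rho) makes the majorant telescope, so a block of the series from N to N + M
    is at most L rho^N - L rho^{N+M}; then M tends to infinity. The bound depends on the terms only
    through c and rho, which is what later makes it uniform. *)
Lemma series_tail s z (c rho : R) : 0 <= c -> 0 < rho < 1 ->
  (forall k, nrm (s k) <= c * rho ^+ k) ->
  ((fun N => \sum_(k < N) s k) @ \oo --> z) ->
  forall N, nrm (\sum_(k < N) s k - z) <= c / (1 - rho) * rho ^+ N.
Proof.
move=> c0 /andP[r0 r1] sc /cvgCP sz N.
have r1' : 0 < 1 - rho by rewrite subr_gt0.
pose L := c / (1 - rho).
have cL : c = L * (1 - rho) by rewrite divfK ?gt_eqF.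
have L0 : 0 <= L by rewrite divr_ge0 // ltW.
have bnd M : nrm (\sum_(k < N) s k - \sum_(k < (N + M)) s k)
    <= L * rho ^+ N - L * rho ^+ (N + M).
  elim: M => [|M IH]; first by rewrite addn0 !subrr nrm0.
  rewrite addnS big_ord_recr /= opprD addrA.
  apply: le_trans (nrmD _ _) _; rewrite nrmN.
  apply: le_trans (lerD IH (sc _)) _; rewrite cL exprS.
  by rewrite le_eqVlt; apply/orP; left; apply/eqP; ring.
apply/ler_addgt0Pr => e e0; have [M HM] := sz e e0.
have -> : \sum_(k < N) s k - z = (\sum_(k < N) s k - \sum_(k < (N + M)) s k) -
    (z - \sum_(k < (N + M)) s k) by ring.
apply: le_trans (nrmD _ _) _; rewrite nrmN; apply: lerD.
  by apply: le_trans (bnd M) _; rewrite gerBl mulr_ge0 ?exprn_ge0 ?(ltW r0).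
by apply: ltW; apply: HM; rewrite leq_addl.
Qed.

Lemma geo_series s : geo (fun k => nrm (s k)) ->
  exists z, gcvg (fun N => \sum_(k < N) s k) z.
Proof.
move=> [K [rho [K0 r01 sK]]]; have /andP[r0 r1] := r01.
have r1' : 0 < 1 - rho by rewrite subr_gt0.
have [] := @abs_series_cvgC s.
  exists (K / (1 - rho)) => N; suff : \sum_(k < N) nrm (s k) <=
     K / (1 - rho) * (1 - rho ^+ N).
    move/le_trans; apply; rewrite ler_piMr ?divr_ge0 ?(ltW r1') //.
    by rewrite gerBl exprn_ge0 // ltW.
  elim: N => [|N IH]; first by rewrite big_ord0 expr0 subrr mulr0.
  rewrite big_ord_recr /=; apply: le_trans (lerD IH (sK N)) _.
  rewrite -[X in _ + X * _](@divfK _ (1 - rho)) ?gt_eqF // exprS.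
  by rewrite le_eqVlt; apply/orP; left; apply/eqP; ring.
move=> z sz; exists z; exists (K / (1 - rho)), rho; split=> //.
  by rewrite divr_ge0 // ltW.
apply: series_tail => //; apply: eq_cvgC sz => N.
by rewrite /series /= big_mkord.
Qed.

End ComplexSequences.

(** * Power series converging geometrically and uniformly on the closed disc *)

Section PowerSeries.
Variable R : realType.
Local Notation C := R[i].
Implicit Types (f g : C -> C) (a : nat -> C).

                                                                            
                  
(** An elementary stand-in for holomorphy on a neighbourhood of the closed disc with Taylor
    coefficients [a]: the remainder bound [b] does not depend on z. *)
Definition ana f a : Prop := exists2 b : nat -> R, geo b &
  forall N z, nrm z <= 1 -> nrm (f z - \sum_(k < N) a k * z ^+ k) <= b N.

(** At z = 1 the coefficient is the difference of two consecutive remainders. *)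
Lemma ana_coef_geo f a : ana f a -> geo (fun k => nrm (a k)).
Proof.
move=> [b gb fb]; apply: geo_le (geoD (geoS gb) gb) => k.
have norm1 : nrm (1 : C) <= 1 by rewrite nrm1.
have -> : a k = - (f 1 - \sum_(i < k.+1) a i * 1 ^+ i) +
    (f 1 - \sum_(i < k) a i * 1 ^+ i).
  by rewrite big_ord_recr /= expr1n mulr1; ring.
by apply: le_trans (nrmD _ _) _; rewrite nrmN lerD // fb.
Qed.

Lemma ana_at0 f a : ana f a -> f 0 = a 0%N.
Proof.
move=> [b gb fb]; apply/eqP; rewrite -subr_eq0; apply/eqP/nrm_eq0/eqP.
rewrite eq_le nrm_ge0 andbT; apply: geo_const_le0.
apply: geo_le (geoS gb) => N; have := fb N.+1 0; rewrite nrm0 => /(_ ler01).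
rewrite big_ord_recl /= expr0 mulr1 big1 ?addr0 // => i _.
by rewrite exprS mul0r mulr0.
Qed.

Lemma ana_bounded f a : ana f a ->
  exists2 M, 0 <= M & forall z, nrm z <= 1 -> nrm (f z) <= M.
Proof.
move=> [b gb fb]; exists `|b 0%N| => // z /(fb 0%N).
by rewrite big_ord0 subr0 => /le_trans; apply; exact: ler_norm.
Qed.

Lemma ana_unique f g a z :
  ana f a -> ana g a -> nrm z <= 1 -> f z = g z.
Proof.
move=> [b gb fb] [c gc gcb] z1.
apply: (@gcvg_unique _ (fun N => \sum_(k < N) a k * z ^+ k)).
- by apply: geo_le gb => N; rewrite nrm_dist fb.
- by apply: geo_le gc => N; rewrite nrm_dist gcb.
Qed.

Lemma eq_ana f g a : (forall z, nrm z <= 1 -> f z = g z) -> ana f a -> ana g a.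
Proof.
by move=> fg [b gb fb]; exists b => // N z z1; rewrite -fg //; exact: fb.
Qed.

Lemma anaD f g a b : ana f a -> ana g b ->
  ana (fun z => f z + g z) (fun k => a k + b k).
Proof.
move=> [c gc fc] [d gd fd]; exists (fun k => c k + d k); first exact: geoD.
move=> N z z1; apply: le_trans (lerD (fc N z z1) (fd N z z1)).
apply: le_trans (nrmD _ _); rewrite le_eqVlt; apply/orP; left; apply/eqP.
congr nrm; under eq_bigr do rewrite mulrDl; rewrite big_split /=; ring.
Qed.

Lemma anaZ c f a : ana f a -> ana (fun z => c * f z) (fun k => c * a k).
Proof.
move=> [b gb fb]; exists (fun k => nrm c * b k).
  exact: geoZ (nrm_ge0 _) gb.
move=> N z z1; under eq_bigr do rewrite -mulrA.
by rewrite -mulr_sumr -mulrBr nrmM ler_wpM2l ?nrm_ge0 ?fb.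
Qed.

Lemma ana0 : ana (fun=> 0) (fun=> 0).
Proof.
exists (fun=> 0) => [|N z _]; first exact: geo0.
by rewrite big1 ?subr0 ?nrm0 // => i _; rewrite mul0r.
Qed.

Lemma ana1 : ana (fun=> 1) (fun k => (k == 0)%:R).
Proof.
exists (fun k => (k == 0)%:R) => [|[|N] z _].
- by apply: (@geo_eventually _ _ (fun=> 0) 1); [case|exact: geo0].
- by rewrite big_ord0 subr0 nrm1.
rewrite big_ord_recl /= expr0 mulr1 big1 ?addr0 ?subrr ?nrm0 // => i _.
by rewrite mul0r.
Qed.

Lemma ana_sum (I : Type) (s : seq I) (F : I -> C -> C) (a : I -> nat -> C) :
  (forall i, ana (F i) (a i)) ->
  ana (fun z => \sum_(i <- s) F i z) (fun k => \sum_(i <- s) a i k).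
Proof.
move=> Fa; elim: s => [|i s IH].
  have -> : (fun k : nat => \sum_(i <- [::]) a i k) = (fun=> 0).
    by apply/funext => k; rewrite big_nil.
  by apply: eq_ana ana0 => z _; rewrite big_nil.
have -> : (fun k : nat => \sum_(j <- i :: s) a j k) =
    (fun k => a i k + \sum_(j <- s) a j k).
  by apply/funext => k; rewrite big_cons.
by apply: eq_ana (anaD (Fa i) IH) => z _; rewrite big_cons.
Qed.

Lemma ana_mulX f a : ana f a ->
  ana (fun z => z * f z) (fun k => if k is k'.+1 then a k' else 0).
Proof.
move=> fa; have [M M0 fM] := ana_bounded fa; case: fa => b gb fb.
exists (fun k => if k is k'.+1 then b k' else M); first exact: geo_unshift.
case=> [|N] z z1.
  by rewrite big_ord0 subr0 nrmM -[M]mul1r ler_pM ?nrm_ge0 ?fM.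
rewrite big_ord_recl /= mul0r add0r.
have -> : \sum_(i < N) a i * z ^+ lift ord0 i = z * \sum_(i < N) a i * z ^+ i.
  by rewrite mulr_sumr; apply: eq_bigr => i _; rewrite exprS; ring.
rewrite -mulrBr nrmM -[b N]mul1r ler_pM ?nrm_ge0 //; exact: fb.
Qed.

                                                                 
(** The Taylor coefficients of f / (z - w), obtained by solving (z - w) d(z) = f(z) degree by
    degree. *)
Fixpoint div_coef (w : C) a k : C :=
  if k is k'.+1 then (div_coef w a k' - a k) / w else - a 0%N / w.

(** Because |w| > 1, the recursion for the new coefficients contracts by 1/|w|, so they decay by
    [geo_rec]; and |z - w| is at least |w| - 1 on the closed disc, so dividing the remainder is
    harmless. *)
Lemma ana_div f a w : 1 < nrm w -> ana f a ->
  ana (fun z => f z / (z - w)) (div_coef w a).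
Proof.
move=> w1 fa; have ga := ana_coef_geo fa; case: fa => b gb fb.
have w0 : 0 < nrm w by apply: lt_trans w1.
have wn0 : w != 0 by apply: contraTneq w0 => ->; rewrite nrm0 ltxx.
have gd : geo (fun k => nrm (div_coef w a k)).
  apply: (@geo_rec _ (nrm w)^-1 _ (fun k => nrm (a k.+1) / nrm w)).
  - by rewrite invr_ge0 (ltW w0) invf_lt1.
  - by apply: geoZr; [rewrite invr_ge0 ltW|exact: geoS ga].
  - move=> k /=; rewrite nrmM nrmV [X in _ <= X + _]mulrC -mulrDl.
    rewrite ler_wpM2r ?invr_ge0 ?(ltW w0) //.
    by apply: le_trans (nrmD _ _) _; rewrite nrmN.
(* Multiplying a partial sum back by z - w reproduces the partial sum of f, up to one top-degree
   term that decays. *)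
have tele N z : (z - w) * \sum_(k < N) div_coef w a k * z ^+ k =
    \sum_(k < N) a k * z ^+ k +
    (if N is N'.+1 then div_coef w a N' * z ^+ N else 0).
  elim: N => [|N IH]; first by rewrite !big_ord0 mulr0 addr0.
  rewrite big_ord_recr [in RHS]big_ord_recr /= mulrDr IH.
  case: N {IH} => [|N] /=; rewrite ?expr0 !exprS; first by field.
  by field.
have e0 : 0 < nrm w - 1 by rewrite subr_gt0.
exists (fun k => (b k + (if k is k'.+1 then nrm (div_coef w a k') else 0))
  / (nrm w - 1)).
  apply: geoZr; first by rewrite invr_ge0 ltW.
  by apply: geoD => //; apply: geo_unshift.
move=> N z z1.
have zw : nrm w - 1 <= nrm (z - w).
  rewrite lerBlDl; apply: le_trans (lerD z1 (lexx _)).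
  rewrite nrm_dist -[in leLHS](subrK z w) addrC; exact: nrmD.
have zw0 : 0 < nrm (z - w) by apply: lt_le_trans zw.
have zwn0 : z - w != 0 by apply: contraTneq zw0 => ->; rewrite nrm0 ltxx.
have -> : f z / (z - w) - \sum_(k < N) div_coef w a k * z ^+ k =
    (f z - (z - w) * \sum_(k < N) div_coef w a k * z ^+ k) / (z - w).
  by field.
rewrite tele nrmM nrmV ler_pM ?invr_ge0 ?nrm_ge0 //; last first.
  by rewrite lef_pV2 ?posrE.
rewrite opprD addrA; apply: le_trans (nrmD _ _) _; rewrite nrmN.
apply: lerD; first exact: fb.
case: N => [|N]; first by rewrite nrm0.
by rewrite nrmM nrmX ler_piMr ?nrm_ge0 // exprn_ile1 ?nrm_ge0.
Qed.

Lemma ana_polyM (p : {poly C}) f a : ana f a ->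
  exists a', ana (fun z => p.[z] * f z) a'.
Proof.
move=> fa; elim/poly_ind: p => [|p c [a' IH]].
  by exists (fun=> 0); apply: eq_ana ana0 => z _; rewrite horner0 mul0r.
eexists; apply: eq_ana (anaD (ana_mulX IH) (anaZ c fa)) => z _ /=.
by rewrite hornerD hornerMX hornerC; ring.
Qed.

(** Over an algebraically closed field the denominator splits; its roots lie outside the closed
    disc, so its linear factors can be divided out one at a time with [ana_div]. *)
Lemma ana_rational (p q : {poly C}) : (forall z, nrm z <= 1 -> q.[z] != 0) ->
  exists a, ana (fun z => q.[z]^-1 * p.[z]) a.
Proof.
move=> q0; have [s qs] := closed_field_poly_normal q.
have q_neq0 : q != 0.
  by apply: contraTneq (q0 0 _) => [->|]; rewrite ?horner0 ?eqxx // nrm0.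
have s1 : forall w, w \in s -> 1 < nrm w.
  move=> w ws; rewrite ltNge; apply/negP => /q0 /negP; apply.
  move: ws; rewrite -root_prod_XsubC => /rootP ws.
  by rewrite qs hornerZ ws mulr0.
have [a sa] : exists a, ana (fun z => (\prod_(w <- s) ('X - w%:P)).[z]^-1) a.
  elim: s s1 {qs} => [|w s IH] s1.
    by eexists; apply: eq_ana ana1 => z _; rewrite big_nil hornerC invr1.
  have [|a sa] := IH; first by move=> v vs; apply: s1; rewrite inE vs orbT.
  eexists; apply: eq_ana (ana_div (s1 w (mem_head _ _)) sa) => z _.
  by rewrite big_cons hornerM hornerXsubC invfM mulrC.
have [a' pa] := ana_polyM p (anaZ (lead_coef q)^-1 sa).
exists a'; apply: eq_ana pa => z _.
by rewrite [in RHS]qs hornerZ invfM mulrC.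
Qed.

End PowerSeries.

(** * Powers and resolvent of a stable matrix *)

Section StableMatrices.
Variable R : realType.
Local Notation C := R[i].

                                                                                  
                                                           
(** Cayley-Hamilton replaces the Jordan form. The claim is generalised to A^k B for any B killed by
    a product of factors A - w with |w| < 1, and the factors are peeled off one by one: A^{k+1} B =
    w A^k B + A^k (A - w) B, where the last term decays by induction and [geo_rec] concludes. *)
Lemma stable_geo n (A : 'M[C]_n) : stable A ->
  forall i j, geo (fun k => nrm ((A ^+ k) i j)).
Proof.
case: n A => [|n] A sA; first by case.
have [s cs] := closed_field_poly_normal (char_poly A).
have s1 w : w \in s -> nrm w < 1.
  move=> ws; rewrite -(ltcR (nrm w) 1) -nrmE; apply: sA.
  rewrite eigenvalue_root_char cs (monicP (char_poly_monic A)) scale1r.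
  by rewrite root_prod_XsubC.
suff H t (B : 'M[C]_n.+1) : (forall w, w \in t -> nrm w < 1) ->
    (\prod_(w <- t) (A - w%:M)) * B = 0 ->
    forall i j, geo (fun k => nrm ((A ^+ k * B) i j)).
  move=> i j; apply: geo_le (H s 1 s1 _ i j) => [k|]; first by rewrite mulr1.
  rewrite mulr1 -[RHS](Cayley_Hamilton A) cs.
  rewrite (monicP (char_poly_monic A)) scale1r rmorph_prod.
  by apply: eq_bigr => w _; rewrite rmorphB /= horner_mx_X horner_mx_C.
elim/last_ind: t B => [|t w IH] B t1.
  rewrite big_nil mul1r => -> i j; apply: geo_le (geo0 R) => k.
  by rewrite mulr0 mxE nrm0.
rewrite big_rcons /= -mulrA => /IH{}IH i j.
have w1 : nrm w < 1 by apply: t1; rewrite mem_rcons mem_head.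
have {}IH : geo (fun k => nrm ((A ^+ k * ((A - w%:M) * B)) i j)).
  by apply: IH => v vt; apply: t1; rewrite mem_rcons inE vt orbT.
apply: (geo_rec _ IH (l := nrm w)); first by rewrite nrm_ge0.
move=> k; rewrite -nrmM; apply: le_trans (nrmD _ _).
rewrite le_eqVlt; apply/orP; left; apply/eqP; congr nrm.
have -> : A ^+ k.+1 * B = w *: (A ^+ k * B) + A ^+ k * ((A - w%:M) * B).
  rewrite mulrBl mulrBr -scalemx1 -!mulmxE -scalemxAl mul1mx -scalemxAr.
  by rewrite addrC subrK exprSr -!mulmxE mulmxA.
by rewrite [LHS]mxE [in LHS]mxE.
Qed.

(** A null vector of 1 - zA would make 1/z an eigenvalue of A of modulus at least 1. *)
Lemma stable_unitmx n (A : 'M[C]_n) z : stable A -> nrm z <= 1 ->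
  1%:M - z *: A \in unitmx.
Proof.
move=> sA z1; rewrite unitmxE unitfE; apply/negP => /det0P[v v0].
rewrite mulmxBr mulmx1 -scalemxAr => /eqP; rewrite subr_eq0 => /eqP vA.
have zn0 : z != 0 by apply: contraNneq v0 => z0; rewrite vA z0 scale0r.
have : eigenvalue A z^-1.
  by apply/eigenvalueP; exists v => //; rewrite [in RHS]vA scalerA mulVf ?scale1r.
move/sA; rewrite nrmE (ltcR _ 1) nrmV => z1'.
have z0 : 0 < nrm z.
  by rewrite lt_neqAle nrm_ge0 andbT eq_sym; apply: contraNneq zn0 => /nrm_eq0 ->.
by move: z1'; rewrite invf_lt1 // ltNge z1.
Qed.

(** The Neumann series. The identity for its partial sums only identifies the limit for each fixed
    z; the bound uniform in z comes from [series_tail], whose constants depend on the powers of A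
    alone. *)
Lemma ana_resolvent n (A : 'M[C]_n) : stable A -> forall i j,
  ana (fun z => invmx (1%:M - z *: A) i j) (fun k => (A ^+ k) i j).
Proof.
move=> sA i j; have gA := stable_geo sA.
have [K [rho [K0 r01 AK]]] := gA i j.
exists (fun N => K / (1 - rho) * rho ^+ N).
  exists (K / (1 - rho)), rho; split=> //.
  by case/andP: r01 => _ r1; rewrite divr_ge0 // subr_ge0 ltW.
move=> N z z1; rewrite nrm_dist.
apply: (@series_tail _ (fun k => (A ^+ k) i j * z ^+ k)) => // [k|].
  rewrite nrmM; apply: le_trans (AK k).
  by rewrite ler_piMr ?nrm_ge0 // nrmX exprn_ile1 // nrm_ge0.
apply: gcvg_cvg => {N}; set B := invmx _.
have zk1 k : nrm (z ^+ k) <= 1 by rewrite nrmX exprn_ile1 // nrm_ge0.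
have neu N : \sum_(k < N) z ^+ k *: A ^+ k = B - z ^+ N *: (B *m A ^+ N).
  apply: (can_inj (mulKmx (stable_unitmx sA z1))).
  rewrite mulmxBr mulmxV ?stable_unitmx // -scalemxAr mulmxA.
  rewrite mulmxV ?stable_unitmx // mul1mx.
  elim: N => [|N IH]; first by rewrite big_ord0 mulmx0 !expr0 scale1r subrr.
  rewrite big_ord_recr /= mulmxDr IH mulmxBl mul1mx -scalemxAl -scalemxAr scalerA.
  by rewrite -exprS mulmxE -exprS addrA subrK.
have gB : geo (fun N => \sum_l nrm (B i l) * nrm ((A ^+ N) l j)).
  by apply: geo_sum => l; apply: geoZ (nrm_ge0 _) (gA l j).
apply: geo_le gB => N.
have -> : \sum_(k < N) (A ^+ k) i j * z ^+ k = (\sum_(k < N) z ^+ k *: A ^+ k) i j.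
  by rewrite summxE; apply: eq_bigr => k _; rewrite mxE mulrC.
have -> : (\sum_(k < N) z ^+ k *: A ^+ k) i j - B i j =
    - (z ^+ N * (B *m A ^+ N) i j) by rewrite neu !mxE; ring.
rewrite nrmN nrmM.
apply: (@le_trans _ _ (nrm ((B *m A ^+ N) i j))).
  by rewrite ler_piMl ?nrm_ge0.
rewrite mxE; apply: le_trans (nrm_sum _ _ _) _.
by apply: ler_sum => l _; rewrite nrmM.
Qed.

Lemma ana_realization p q n (B : 'M[C]_(p, n)) (A : 'M[C]_n) (G : 'M[C]_(n, q)) :
  stable A -> forall a b,
  ana (fun z => (B *m invmx (1%:M - z *: A) *m G) a b)
      (fun k => (B *m A ^+ k *m G) a b).
Proof.
move=> sA a b.
have H := ana_sum (index_enum 'I_n) (fun j => anaZ (G j b)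
  (ana_sum (index_enum 'I_n) (fun i => anaZ (B a i) (ana_resolvent sA i j)))).
have -> : (fun k => (B *m A ^+ k *m G) a b) =
    (fun k => \sum_j G j b * \sum_i B a i * (A ^+ k) i j).
  by apply/funext => k; rewrite mxE; apply: eq_bigr => j _; rewrite mxE mulrC.
apply: eq_ana H => z _; rewrite mxE; apply: eq_bigr => j _.
by rewrite mxE mulrC.
Qed.

End StableMatrices.

(** * Means over the unit circle and Fourier coefficients of power series *)

Section CircleMean.
Variable R : realType.
Local Notation C := R[i].
Local Notation mu := (@lebesgue_measure R).
Implicit Types (h g : R -> C) (f : R -> R).

Lemma pi2_gt0 : 0 < 2 * pi :> R.
Proof. by rewrite mulr_gt0 // pi_gt0. Qed.

Lemma continuous_integrable f : continuous f ->
  mu.-integrable `[0, 2 * pi] (EFin \o f).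
Proof.
move=> cf; apply: continuous_compact_integrable; first exact: segment_compact.
exact: continuous_subspaceT.
Qed.

Lemma uniform_geo_continuous (F : nat -> R -> R) (b : nat -> R) f : geo b ->
  (forall N, continuous (F N)) -> (forall N t, `|f t - F N t| <= b N) ->
  continuous f.
Proof.
move=> gb cF fF t; apply/cvgrPdist_lt => e e0.
have e3 : 0 < e / 3 by rewrite divr_gt0.
have [N /(_ N (leqnn N)) bN] := geo_lt gb e3.
have /cvgrPdist_lt /(_ _ e3) := cF N t.
apply: filterS => u tu.
have -> : f t - f u = (f t - F N t) + (F N t - F N u) - (f u - F N u) by ring.
apply: le_lt_trans (ler_normB _ _) _.
apply: le_lt_trans (lerD (ler_normD _ _) (lexx _)) _.
have := fF N t; have := fF N u; lra.
Qed.

Definition ccont h : Prop :=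
  continuous (fun t => complex.Re (h t)) /\ continuous (fun t => complex.Im (h t)).

Lemma eq_ccont h g : h =1 g -> ccont h -> ccont g.
Proof. by move=> /funext ->. Qed.

Lemma ccontD h g : ccont h -> ccont g -> ccont (fun t => h t + g t).
Proof.
move=> [hr hi] [gr gi]; split;
  [under eq_fun do rewrite cReD|under eq_fun do rewrite cImD].
- by move=> t; apply: cvgD; [exact: hr|exact: gr].
- by move=> t; apply: cvgD; [exact: hi|exact: gi].
Qed.

Lemma cReM (x y : C) : complex.Re (x * y) =
  complex.Re x * complex.Re y - complex.Im x * complex.Im y.
Proof. by case: x; case: y. Qed.

Lemma cImM (x y : C) : complex.Im (x * y) =
  complex.Re x * complex.Im y + complex.Im x * complex.Re y.
Proof. by case: x; case: y. Qed.

Lemma ccontM h g : ccont h -> ccont g -> ccont (fun t => h t * g t).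
Proof.
move=> [hr hi] [gr gi]; split;
  [under eq_fun do rewrite cReM|under eq_fun do rewrite cImM].
- by move=> t; apply: cvgB; apply: cvgM;
    [exact: hr|exact: gr|exact: hi|exact: gi].
- by move=> t; apply: cvgD; apply: cvgM;
    [exact: hr|exact: gi|exact: hi|exact: gr].
Qed.

Lemma ccont_cst (c : C) : ccont (fun=> c).
Proof. by split=> t; exact: cvg_cst. Qed.

Lemma cReJ (z : C) : complex.Re (Num.conj z) = complex.Re z.
Proof. by case: z. Qed.

Lemma cImJ (z : C) : complex.Im (Num.conj z) = - complex.Im z.
Proof. by case: z. Qed.

Lemma ccont_conj h : ccont h -> ccont (fun t => Num.conj (h t)).
Proof.
move=> [hr hi]; split;
  [under eq_fun do rewrite cReJ|under eq_fun do rewrite cImJ].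
- exact: hr.
- by move=> t; apply: cvgN; exact: hi.
Qed.

Lemma ccont_sum (I : Type) (s : seq I) (F : I -> R -> C) :
  (forall i, ccont (F i)) -> ccont (fun t => \sum_(i <- s) F i t).
Proof.
move=> cF; elim: s => [|i s IH].
  by apply: eq_ccont (ccont_cst 0) => t; rewrite big_nil.
by apply: eq_ccont (ccontD (cF i) IH) => t; rewrite big_cons.
Qed.

Lemma ccont_expi (k : R) : ccont (fun t => expi (k * t)).
Proof.
have ck : continuous (fun t : R => k * t).
  by move=> t; apply: cvgMr; exact: cvg_id.
split=> t; apply: (continuous_comp (ck t)).
- exact: continuous_cos.
- exact: continuous_sin.
Qed.

Definition mean h : C :=
  Complex ((2 * pi)^-1 * \int[mu]_(t in `[0, 2 * pi]) complex.Re (h t))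
          ((2 * pi)^-1 * \int[mu]_(t in `[0, 2 * pi]) complex.Im (h t)).

Lemma eq_mean h g : h =1 g -> mean h = mean g.
Proof. by move=> /funext ->. Qed.

Lemma meanD h g : ccont h -> ccont g ->
  mean (fun t => h t + g t) = mean h + mean g.
Proof.
move=> [hr hi] [gr gi]; apply/eqP; rewrite eq_complex /=.
under eq_Rintegral do rewrite cReD.
rewrite RintegralD //; [|exact: continuous_integrable..].
rewrite mulrDr eqxx /=.
under eq_Rintegral do rewrite cImD.
rewrite RintegralD //; [|exact: continuous_integrable..].
by rewrite mulrDr.
Qed.

Lemma meanZ (c : C) h : ccont h -> mean (fun t => c * h t) = c * mean h.
Proof.
have cZ (a : R) f : continuous f -> continuous (fun t => a * f t).
  by move=> cf t; apply: cvgMr; exact: cf.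
move=> [hr hi]; apply/eqP; rewrite eq_complex cReM cImM /=.
apply/andP; split; apply/eqP.
- under eq_Rintegral do rewrite cReM.
  rewrite RintegralB //; [|apply: continuous_integrable; exact: cZ..].
  by rewrite !RintegralZl //; [ring|exact: continuous_integrable..].
- under eq_Rintegral do rewrite cImM.
  rewrite RintegralD //; [|apply: continuous_integrable; exact: cZ..].
  by rewrite !RintegralZl //; [ring|exact: continuous_integrable..].
Qed.

Lemma mean_sum (I : Type) (s : seq I) (F : I -> R -> C) :
  (forall i, ccont (F i)) ->
  mean (fun t => \sum_(i <- s) F i t) = \sum_(i <- s) mean (F i).
Proof.
move=> cF; elim: s => [|i s IH].
  rewrite big_nil (@eq_mean _ (fun t => 0 * 0)).
    by rewrite (@meanZ 0 (fun=> 0)) ?mul0r //; exact: ccont_cst.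
  by move=> t; rewrite big_nil mul0r.
rewrite big_cons -IH -meanD //; last exact: ccont_sum.
by apply: eq_mean => t; rewrite big_cons.
Qed.

Lemma mean_conj h : ccont h -> mean (fun t => Num.conj (h t)) = Num.conj (mean h).
Proof.
move=> [hr hi]; apply/eqP; rewrite eq_complex cReJ cImJ /=.
under eq_Rintegral do rewrite cReJ.
under [X in _ && (_ * X == _)]eq_Rintegral do rewrite cImJ -mulN1r.
rewrite RintegralZl //; last exact: continuous_integrable.
by rewrite eqxx mulN1r mulrN eqxx.
Qed.

(** The factor 2 comes from estimating real and imaginary parts separately; only smallness matters
    later. *)
Lemma mean_bound h (e : R) : ccont h -> (forall t, nrm (h t) <= e) ->
  nrm (mean h) <= 2 * e.
Proof.
have aux f : continuous f -> (forall t, `|f t| <= e) ->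
    `|(2 * pi)^-1 * \int[mu]_(t in `[0, 2 * pi]) f t| <= e.
  move=> cf fe; rewrite normrM gtr0_norm ?invr_gt0 ?pi2_gt0 //.
  rewrite mulrC ler_pdivrMr ?pi2_gt0 //.
  apply: le_trans (le_normr_Rintegral _ (continuous_integrable cf)) _ => //.
  have cn : continuous (fun t => `|f t|).
    by move=> t; apply: cvg_norm; exact: cf.
  apply: le_trans (le_Rintegral (f2 := fun=> e) _ (continuous_integrable cn) _ _) _.
  - by [].
  - by apply: continuous_integrable => t; exact: cvg_cst.
  - by [].
  rewrite Rintegral_cst //= lebesgue_measure_itv /= lte_fin pi2_gt0 /=.
  by rewrite subr0.
move=> [hr hi] he; apply: le_trans (nrm_le_ReIm _) _; rewrite mulr2n mulrDl mul1r.
apply: lerD; apply: aux => // t; apply: le_trans (he t).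
  exact: Re_le_nrm.
exact: Im_le_nrm.
Qed.

Lemma expiD (a b : R) : expi (a + b) = expi a * expi b.
Proof.
apply/eqP; rewrite eq_complex cReM cImM /= cosD sinD eqxx /=.
by rewrite addrC.
Qed.

Lemma expi0 : expi 0 = 1 :> C.
Proof. by rewrite /expi cos0 sin0. Qed.

Lemma expiX (t : R) k : expi t ^+ k = expi (k%:R * t).
Proof.
elim: k => [|k IH]; first by rewrite mul0r expi0.
by rewrite exprS IH -expiD -add1n natrD mulrDl mul1r.
Qed.

Lemma conj_expi (t : R) : Num.conj (expi t) = expi (- t).
Proof. by apply/eqP; rewrite eq_complex cReJ cImJ /= cosN sinN !eqxx. Qed.

Lemma nrm_expi (t : R) : nrm (expi t) = 1.
Proof. by rewrite /nrm /= cos2Dsin2 sqrtr1. Qed.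

Lemma expi2pi (k : int) : expi (k%:~R * (2 * pi)) = 1 :> C.
Proof.
have H (n : nat) : expi (n%:R * (2 * pi)) = 1 :> C.
  rewrite -expiX (_ : 2 * pi = pi *+ 2); last by rewrite mulr_natl.
  by rewrite /expi cos2pi sin2pi expr1n.
case: k => n; first exact: H.
rewrite NegzE mulrNz mulNr -conj_expi (H n.+1).
exact: rmorph1.
Qed.

(** For k nonzero, cosine and sine of kt have antiderivatives with equal values at 0 and 2 pi, so
    the fundamental theorem of calculus gives 0. *)
Lemma mean_expi (k : int) : mean (fun t => expi (k%:~R * t)) = (k == 0)%:R.
Proof.
have [->|k0] := eqVneq k 0.
  rewrite (@eq_mean _ (fun=> 1)); last by move=> t; rewrite mul0r expi0.
  apply/eqP; rewrite eq_complex /= !Rintegral_cst //=.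
  rewrite lebesgue_measure_itv /= lte_fin pi2_gt0 /= subr0 mul1r mul0r mulr0.
  by rewrite mulVf ?eqxx // gt_eqF // pi2_gt0.
set r : R := k%:~R; have r0 : r != 0 by rewrite intr_eq0.
have [cc cs] := ccont_expi r; have := expi2pi k; rewrite -/r => -[c2 s2].
have dl (x : R) : is_derive x 1 (fun t : R => r * t) r.
  have d := is_deriveZ r (is_derive_id x (1 : R)).
  by apply: (@is_derive_eq _ _ _ _ _ _ _ _ d); rewrite /GRing.scale /= mulr1.
have ftc f (F : R -> R) : continuous f -> (forall x : R, is_derive x 1 F (f x)) ->
    F (2 * pi) = F 0 -> \int[mu]_(t in `[0, 2 * pi]) f t = 0.
  move=> cf dF FF.
  have cF : continuous F.
    move=> x; apply: differentiable_continuous; apply/derivable1_diffP.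
    by case: (dF x).
  rewrite /Rintegral (continuous_FTC2 pi2_gt0 (F := F)).
  - by rewrite FF subee.
  - exact: continuous_subspaceT.
  - split=> [x _||]; first by case: (dF x).
    + by apply: cvg_at_right_filter; exact: cF.
    + by apply: cvg_at_left_filter; exact: cF.
  - by move=> x _; rewrite derive1E; case: (dF x).
have ds (x : R) : is_derive x 1 (fun t : R => r^-1 * sin (r * t)) (cos (r * x)).
  have d := is_deriveZ r^-1 (is_derive1_comp (is_derive_sin (r * x)) (dl x)).
  apply: (@is_derive_eq _ _ _ _ _ _ _ _ d); rewrite /GRing.scale /=.
  by rewrite mulrCA mulVf ?mulr1.
have dc (x : R) : is_derive x 1 (fun t : R => - r^-1 * cos (r * t)) (sin (r * x)).
  have d := is_deriveZ (- r^-1) (is_derive1_comp (is_derive_cos (r * x)) (dl x)).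
  apply: (@is_derive_eq _ _ _ _ _ _ _ _ d); rewrite /GRing.scale /=.
  by rewrite !mulNr mulrN opprK mulrCA mulVf ?mulr1.
apply/eqP; rewrite eq_complex /= (ftc _ _ cc ds) ?(ftc _ _ cs dc) ?mulr0 ?eqxx //.
- by rewrite c2 cos0.
- by rewrite s2 sin0.
Qed.

Lemma ana_ccont (f : C -> C) a : ana f a -> ccont (fun t => f (expi t)).
Proof.
move=> [b gb fb].
have cF N : ccont (fun t => \sum_(k < N) a k * expi t ^+ k).
  apply: ccont_sum => k; apply: ccontM; first exact: ccont_cst.
  by under eq_fun do rewrite expiX; exact: ccont_expi.
split.
- apply: (uniform_geo_continuous gb (fun N => (cF N).1)) => N t.
  rewrite -cReN -cReD; apply: le_trans (Re_le_nrm _) _.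
  by apply: fb; rewrite nrm_expi.
- apply: (uniform_geo_continuous gb (fun N => (cF N).2)) => N t.
  rewrite -cImN -cImD; apply: le_trans (Im_le_nrm _) _.
  by apply: fb; rewrite nrm_expi.
Qed.

(** By orthogonality of the exponentials, the mean of the N-th partial sum is exactly the claimed
    value as soon as N > |k|; the uniform remainder bound transfers this to f. *)
Lemma mean_ana (f : C -> C) a (k : int) : ana f a ->
  mean (fun t => f (expi t) * expi (- (k%:~R * t))) =
  if k is Posz n then a n else 0.
Proof.
move=> fa; have cf := ana_ccont fa; case: fa => b gb fb.
have ce : ccont (fun t => expi (- (k%:~R * t))).
  by under eq_fun do rewrite -mulNr; exact: ccont_expi.
set c := RHS; pose e t : C := expi (- (k%:~R * t)).
have term (l : nat) : mean (fun t => a l * (expi t ^+ l * e t)) =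
    a l * (l%:Z == k)%:R.
  have le t : expi t ^+ l * e t = expi ((l%:Z - k)%:~R * t).
    by rewrite expiX -expiD; congr expi; rewrite rmorphB /=; ring.
  under eq_fun do rewrite le.
  by rewrite meanZ ?mean_expi ?subr_eq0 //; exact: ccont_expi.
have cterm l : ccont (fun t => a l * (expi t ^+ l * e t)).
  apply: ccontM; first exact: ccont_cst.
  by apply: ccontM => //; under eq_fun do rewrite expiX; exact: ccont_expi.
pose F N t : C := \sum_(l < N) a l * (expi t ^+ l * e t).
have cF N : ccont (F N) by apply: ccont_sum.
have FN N : (`|k| < N)%N -> mean (F N) = c.
  move=> kN; rewrite mean_sum //; under eq_bigr do rewrite term.
  rewrite /c; case: k kN {ce e term cterm F cF c} => n /= nN.
    rewrite (bigD1 (Ordinal nN)) //= eqxx mulr1 big1 ?addr0 // => i ni.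
    case: eqVneq => [[iN]|]; last by rewrite mulr0.
    by case/eqP: ni; apply: val_inj.
  by rewrite big1 // => i _; rewrite mulr0.
apply: (@gcvg_unique _ (fun=> mean (fun t => f (expi t) * e t))).
  exact: gcvg_cst.
apply: (@geo_eventually _ _ (fun k => 2 * b k) `|k|.+1); last exact: geoZ.
move=> N /FN <-; rewrite -mulN1r -meanZ // -meanD.
- apply: mean_bound.
    by apply: ccontD; [exact: ccontM|apply: ccontM => //; exact: ccont_cst].
  move=> t; have -> : f (expi t) * e t + -1 * F N t =
      (f (expi t) - \sum_(l < N) a l * expi t ^+ l) * e t.
    rewrite mulrBl mulN1r mulr_suml; congr (_ - _); apply: eq_bigr => i _.
    by rewrite mulrA.
  by rewrite nrmM nrm_expi mulr1; apply: fb; rewrite nrm_expi.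
- exact: ccontM.
- by apply: ccontM => //; exact: ccont_cst.
Qed.

(** A Parseval identity. Only f is expanded: each term conj(a_k z^k) g picks out the coefficient of
    g of index k + j, and the error is at most the remainder of f times a bound for g. *)
Lemma mean_conjM_ana (f g : C -> C) a c (j : nat) : ana f a -> ana g c ->
  gcvg (fun N => \sum_(k < N) Num.conj (a k) * c (k + j)%N)
    (mean (fun t => Num.conj (f (expi t)) * g (expi t) * expi (- (j%:R * t)))).
Proof.
move=> fa ga; have cf := ana_ccont fa; have cg := ana_ccont ga.
have [M M0 gM] := ana_bounded ga; have mg := mean_ana _ ga.
case: fa => b gb fb; pose e t : C := expi (- (j%:R * t)).
have ce : ccont e by rewrite /e; under eq_fun do rewrite -mulNr; exact: ccont_expi.
have term (k : nat) : mean (fun t => Num.conj (a k * expi t ^+ k) * g (expi t) * e t) =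
    Num.conj (a k) * c (k + j)%N.
  have le t : Num.conj (a k * expi t ^+ k) * g (expi t) * e t =
      Num.conj (a k) * (g (expi t) * expi (- ((k + j)%:Z%:~R * t))).
    rewrite rmorphM /= expiX conj_expi -!mulrA; congr (_ * _).
    rewrite mulrCA; congr (_ * _); rewrite -expiD; congr expi.
    by rewrite -pmulrn natrD; ring.
  under eq_fun do rewrite le.
  rewrite meanZ ?mg //; apply: ccontM => //.
  by under eq_fun do rewrite -mulNr; exact: ccont_expi.
have cterm (k : nat) : ccont (fun t => Num.conj (a k * expi t ^+ k) * g (expi t) * e t).
  apply: ccontM => //; apply: ccontM => //; apply: ccont_conj.
  apply: ccontM; first exact: ccont_cst.
  by under eq_fun do rewrite expiX; exact: ccont_expi.
have g2 : geo (fun k => 2 * (b k * M)) by apply: geoZ => //; exact: geoZr.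
apply: geo_le g2 => N; rewrite nrm_dist.
have -> : \sum_(k < N) Num.conj (a k) * c (k + j)%N =
    mean (fun t => \sum_(k < N) Num.conj (a k * expi t ^+ k) * g (expi t) * e t).
  by rewrite mean_sum //; apply: eq_bigr => k _; rewrite term.
have cc : ccont (fun t => Num.conj (f (expi t)) * g (expi t) * e t).
  by apply: ccontM => //; apply: ccontM => //; exact: ccont_conj.
have cs : ccont (fun t => \sum_(k < N) Num.conj (a k * expi t ^+ k) * g (expi t) * e t).
  exact: ccont_sum.
rewrite -mulN1r -meanZ // -meanD //; last by apply: ccontM => //; exact: ccont_cst.
apply: mean_bound.
  by apply: ccontD => //; apply: ccontM => //; exact: ccont_cst.
move=> t; have t1 : nrm (expi t : C) <= 1 by rewrite nrm_expi.
have -> : Num.conj (f (expi t)) * g (expi t) * e t + -1 *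
    \sum_(k < N) Num.conj (a k * expi t ^+ k) * g (expi t) * e t =
    Num.conj (f (expi t) - \sum_(k < N) a k * expi t ^+ k) * g (expi t) * e t.
  rewrite rmorphB rmorph_sum /= !mulrBl mulN1r !mulr_suml.
  by [].
rewrite !nrmM nrm_expi mulr1 nrm_conj ler_pM ?nrm_ge0 //.
- exact: fb.
- exact: gM.
Qed.

End CircleMean.

(** * Matrix norms, square summable sequences and their inner product *)

Section SquareSummable.
Variable R : realType.
Local Notation C := R[i].

Lemma mxadjE p q (M : 'M[C]_(p, q)) i j : mxadj M i j = Num.conj (M j i).
Proof. by rewrite !mxE. Qed.

Lemma mxadjD p q (M N : 'M[C]_(p, q)) : mxadj (M + N) = mxadj M + mxadj N.
Proof. by apply/matrixP => i j; rewrite [RHS]mxE !mxadjE mxE rmorphD. Qed.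

Lemma mxadjZ p q c (M : 'M[C]_(p, q)) : mxadj (c *: M) = Num.conj c *: mxadj M.
Proof. by apply/matrixP => i j; rewrite [RHS]mxE !mxadjE mxE rmorphM. Qed.

Lemma mxadjM p q l (M : 'M[C]_(p, q)) (N : 'M[C]_(q, l)) :
  mxadj (M *m N) = mxadj N *m mxadj M.
Proof. by rewrite /mxadj trmx_mul map_mxM. Qed.

Lemma mxadjK p q (M : 'M[C]_(p, q)) : mxadj (mxadj M) = M.
Proof. by apply/matrixP => i j; rewrite !mxadjE conjCK. Qed.

Lemma mxadj0 p q : mxadj (0 : 'M[C]_(p, q)) = 0.
Proof. by apply/matrixP => i j; rewrite mxadjE !mxE rmorph0. Qed.

Lemma mxadj_sum p q N (F : 'I_N -> 'M[C]_(p, q)) :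
  mxadj (\sum_(k < N) F k) = \sum_(k < N) mxadj (F k).
Proof. by apply: (big_morph _ (@mxadjD p q)); exact: mxadj0. Qed.

(** The entrywise sum norm, chosen because it is submultiplicative by elementary sums and dominates
    each entry. *)
Definition norm1 p q (M : 'M[C]_(p, q)) : R := \sum_i \sum_j nrm (M i j).

Lemma norm1_ge0 p q (M : 'M[C]_(p, q)) : 0 <= norm1 M.
Proof. by apply: sumr_ge0 => i _; apply: sumr_ge0 => j _; exact: nrm_ge0. Qed.

Lemma nrm_le_norm1 p q (M : 'M[C]_(p, q)) i j : nrm (M i j) <= norm1 M.
Proof.
rewrite /norm1 (bigD1 i) //= (bigD1 j) //= -addrA lerDl addr_ge0 //.
  by apply: sumr_ge0 => k _; exact: nrm_ge0.
by apply: sumr_ge0 => k _; apply: sumr_ge0 => l _; exact: nrm_ge0.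
Qed.

Lemma norm1_0 p q : norm1 (0 : 'M[C]_(p, q)) = 0.
Proof. by apply: big1 => i _; apply: big1 => j _; rewrite mxE nrm0. Qed.

Lemma norm1D p q (M N : 'M[C]_(p, q)) : norm1 (M + N) <= norm1 M + norm1 N.
Proof.
rewrite /norm1 -big_split /=; apply: ler_sum => i _.
by rewrite -big_split /=; apply: ler_sum => j _; rewrite mxE nrmD.
Qed.

Lemma norm1Z p q c (M : 'M[C]_(p, q)) : norm1 (c *: M) = nrm c * norm1 M.
Proof.
rewrite /norm1 mulr_sumr; apply: eq_bigr => i _; rewrite mulr_sumr.
by apply: eq_bigr => j _; rewrite mxE nrmM.
Qed.

Lemma norm1_sum p q (I : Type) (s : seq I) (F : I -> 'M[C]_(p, q)) :
  norm1 (\sum_(i <- s) F i) <= \sum_(i <- s) norm1 (F i).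
Proof.
elim: s => [|i s IH]; first by rewrite !big_nil norm1_0.
by rewrite !big_cons; apply: le_trans (norm1D _ _) _; rewrite lerD2l.
Qed.

Lemma norm1_adj p q (M : 'M[C]_(p, q)) : norm1 (mxadj M) = norm1 M.
Proof.
rewrite /norm1 exchange_big /=; apply: eq_bigr => i _; apply: eq_bigr => j _.
by rewrite mxadjE nrm_conj.
Qed.

Lemma norm1M p q l (M : 'M[C]_(p, q)) (N : 'M[C]_(q, l)) :
  norm1 (M *m N) <= norm1 M * norm1 N.
Proof.
rewrite {1 2}/norm1 mulr_suml; apply: ler_sum => i _.
apply: (@le_trans _ _ (\sum_j \sum_k nrm (M i k) * nrm (N k j))).
  apply: ler_sum => j _; rewrite mxE; apply: le_trans (nrm_sum _ _ _) _.
  by apply: ler_sum => k _; rewrite nrmM.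
rewrite exchange_big /= mulr_suml; apply: ler_sum => k _.
rewrite -mulr_sumr ler_wpM2l ?nrm_ge0 // /norm1 (bigD1 k) //= lerDl.
by apply: sumr_ge0 => i' _; apply: sumr_ge0 => j _; exact: nrm_ge0.
Qed.

Lemma geo_norm1 p q (S : nat -> 'M[C]_(p, q)) :
  (forall i j, geo (fun k => nrm (S k i j))) -> geo (fun k => norm1 (S k)).
Proof. by move=> gS; apply: geo_sum => i; apply: geo_sum => j. Qed.

(** Membership in l2 phrased by bounded partial sums, with [norm1] instead of the Euclidean norm;
    [l2P] links it to [l2]. *)
Definition sqsum p (u : nat -> 'cV[C]_p) : Prop :=
  exists M, forall N, \sum_(j < N) norm1 (u j) ^+ 2 <= M.

Definition sqnR p (v : 'cV[C]_p) : R := \sum_i nrm (v i 0) ^+ 2.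

Lemma sqnE p (v : 'cV[C]_p) : sqn v = (sqnR v)%:C%C.
Proof.
rewrite /sqn /sqnR rmorph_sum /=; apply: eq_bigr => i _.
by rewrite nrmE rmorphXn.
Qed.

Lemma sqnR_ge0 p (v : 'cV[C]_p) : 0 <= sqnR v.
Proof. by apply: sumr_ge0 => i _; rewrite exprn_ge0 // nrm_ge0. Qed.

Lemma sqnR_le_norm1 p (v : 'cV[C]_p) : sqnR v <= norm1 v ^+ 2.
Proof.
rewrite /sqnR expr2 {1}/norm1 mulr_suml; apply: ler_sum => i _.
by rewrite big_ord1 expr2 ler_wpM2l ?nrm_ge0 ?nrm_le_norm1.
Qed.

Lemma norm1_le_sqnR p (v : 'cV[C]_p) : norm1 v ^+ 2 <= p%:R ^+ 2 * sqnR v.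
Proof.
have s0 : 0 <= Num.sqrt (sqnR v) by exact: sqrtr_ge0.
rewrite -[sqnR v]sqr_sqrtr ?sqnR_ge0 // -exprMn ler_sqr ?nnegrE ?norm1_ge0 ?mulr_ge0 //.
apply: (@le_trans _ _ (\sum_(i < p) Num.sqrt (sqnR v))); last first.
  by rewrite sumr_const card_ord mulr_natl.
apply: ler_sum => i _; rewrite big_ord1 -ler_sqr ?nnegrE ?nrm_ge0 //.
rewrite sqr_sqrtr ?sqnR_ge0 // /sqnR (bigD1 i) //= lerDl.
by apply: sumr_ge0 => k _; rewrite exprn_ge0 // nrm_ge0.
Qed.

Lemma nrm_real (x : R) : 0 <= x -> nrm x%:C%C = x.
Proof. by move=> x0; apply: complexI; rewrite -nrmE ger0_norm // (lecR 0). Qed.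

(** A series of nonnegative terms converges if and only if its partial sums are bounded, and the two
    squared norms agree up to the factor p^2. *)
Lemma l2P p (u : nat -> 'cV[C]_p) : l2 u <-> sqsum u.
Proof.
split=> [lu|[M uM]].
  pose z := limn (series (fun j => sqn (u j))).
  have su := @cvgC_Re R (series (fun j => sqn (u j))) z lu.
  exists (p%:R ^+ 2 * complex.Re z) => N.
  apply: (@le_trans _ _ (\sum_(j < N) p%:R ^+ 2 * sqnR (u j))).
    by apply: ler_sum => j _; exact: norm1_le_sqnR.
  rewrite -mulr_sumr ler_wpM2l ?exprn_ge0 //.
  have {su} su : ((fun k => \sum_(j < k) sqnR (u j)) @ \oo --> complex.Re z).
    rewrite (_ : (fun k => _) = (fun k => complex.Re (series (fun j => sqn (u j)) k))) //.
    apply/funext => k; rewrite /series /= big_mkord cRe_sum.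
    by apply: eq_bigr => j _; rewrite sqnE.
  rewrite -(cvg_lim _ su) //; apply: nondecreasing_cvgn_le; last exact: cvgP su.
  apply/nondecreasing_seqP => k.
  by rewrite big_ord_recr /= lerDl sqnR_ge0.
have [|z uz] := @abs_series_cvgC R (fun j => sqn (u j)); last exact: cvgP uz.
exists M => N; apply: le_trans (uM N); apply: ler_sum => j _.
by rewrite sqnE nrm_real ?sqnR_ge0 // sqnR_le_norm1.
Qed.

Lemma sqsum_dom p q (u : nat -> 'cV[C]_p) (v : nat -> 'cV[C]_q) c :
  (forall j, norm1 (u j) <= c * norm1 (v j)) -> sqsum v -> sqsum u.
Proof.
move=> uv [M vM]; exists (c ^+ 2 * M) => N.
apply: (@le_trans _ _ (\sum_(j < N) c ^+ 2 * norm1 (v j) ^+ 2)).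
  apply: ler_sum => j _; rewrite -exprMn ler_sqr ?nnegrE ?norm1_ge0 //.
  exact: le_trans (norm1_ge0 _) (uv j).
by rewrite -mulr_sumr ler_wpM2l ?sqr_ge0.
Qed.

Lemma sqsumD p (u v : nat -> 'cV[C]_p) : sqsum u -> sqsum v ->
  sqsum (fun j => u j + v j).
Proof.
move=> [M uM] [L vL]; exists (2 * M + 2 * L) => N.
apply: le_trans (lerD (ler_wpM2l (ler0n _ 2) (uM N)) (ler_wpM2l (ler0n _ 2) (vL N))).
rewrite !mulr_sumr -big_split /=; apply: ler_sum => j _.
apply: (@le_trans _ _ ((norm1 (u j) + norm1 (v j)) ^+ 2)).
  by rewrite ler_sqr ?nnegrE ?addr_ge0 ?norm1_ge0 ?norm1D.
rewrite -subr_ge0 (_ : _ - _ = (norm1 (u j) - norm1 (v j)) ^+ 2) ?sqr_ge0 //; ring.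
Qed.

Lemma sqsumZ p c (u : nat -> 'cV[C]_p) : sqsum u -> sqsum (fun j => c *: u j).
Proof. by apply: (@sqsum_dom _ _ _ _ (nrm c)) => j; rewrite norm1Z. Qed.

Lemma sqsum_lincomb p c (u v : nat -> 'cV[C]_p) : sqsum u -> sqsum v ->
  sqsum (fun j => c *: u j + v j).
Proof. by move=> su sv; apply: sqsumD => //; exact: sqsumZ. Qed.

Lemma sqsumS p (u : nat -> 'cV[C]_p) : sqsum u -> sqsum (fun j => u j.+1).
Proof.
move=> [M uM]; exists M => N; apply: le_trans (uM N.+1).
by rewrite [leRHS]big_ord_recl lerDr exprn_ge0 // norm1_ge0.
Qed.

(** The forward shift; by [inner_push0] its adjoint is the backward shift. *)
Definition push0 p (u : nat -> 'cV[C]_p) j := if j is j'.+1 then u j' else 0.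

Lemma sqsum_push0 p (u : nat -> 'cV[C]_p) : sqsum u -> sqsum (push0 u).
Proof.
move=> [M uM]; exists M => -[|N]; first by have := uM 0%N; rewrite !big_ord0.
by rewrite big_ord_recl /= norm1_0 expr0n add0r; exact: uM.
Qed.

Lemma sqsum_geo p (u : nat -> 'cV[C]_p) : geo (fun j => norm1 (u j)) -> sqsum u.
Proof.
move=> [K [rho [K0 /andP[r0 r1] uK]]].
have r1' : 0 < 1 - rho by rewrite subr_gt0.
exists (K ^+ 2 / (1 - rho)) => N.
suff : \sum_(j < N) norm1 (u j) ^+ 2 <= K ^+ 2 / (1 - rho) * (1 - rho ^+ N).
  move/le_trans; apply; rewrite ler_piMr ?divr_ge0 ?sqr_ge0 ?(ltW r1') //.
  by rewrite gerBl exprn_ge0 // ltW.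
elim: N => [|N IH]; first by rewrite big_ord0 expr0 subrr mulr0.
rewrite big_ord_recr /=.
have uN : norm1 (u N) ^+ 2 <= K ^+ 2 * rho ^+ N.
  apply: (@le_trans _ _ ((K * rho ^+ N) ^+ 2)).
    by rewrite ler_sqr ?nnegrE ?norm1_ge0 // mulr_ge0 // exprn_ge0 // ltW.
  rewrite exprMn ler_wpM2l ?sqr_ge0 // expr2 ler_piMr ?exprn_ge0 ?(ltW r0) //.
  by rewrite exprn_ile1 // ltW.
apply: le_trans (lerD IH uN) _.
rewrite -[X in _ + X * _](@divfK _ (1 - rho)) ?gt_eqF // (exprS rho N).
by rewrite le_eqVlt; apply/orP; left; apply/eqP; ring.
Qed.

Lemma sqsum_bounded p (u : nat -> 'cV[C]_p) : sqsum u ->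
  exists2 U, 0 <= U & forall j, norm1 (u j) <= U.
Proof.
move=> [M uM]; exists (M + 1).
  by have := uM 0%N; rewrite big_ord0 => M0; rewrite addr_ge0.
move=> j; have nM : norm1 (u j) ^+ 2 <= M.
  apply: le_trans (uM j.+1); rewrite big_ord_recr /= lerDr.
  by apply: sumr_ge0 => i _; rewrite exprn_ge0 // norm1_ge0.
(* From t^2 <= M follows t <= t^2 + 1/4 <= M + 1. *)
have := sqr_ge0 (norm1 (u j) - 2^-1); nra.
Qed.

Lemma inner_cvg p (u v : nat -> 'cV[C]_p) : sqsum u -> sqsum v ->
  ((fun N => \sum_(j < N) (mxadj (v j) *m u j) 0 0) @ \oo --> inner u v).
Proof.
move=> [M uM] [L vL].
have [|z uz] := @abs_series_cvgC R (fun j => (mxadj (v j) *m u j) 0 0).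
  exists (M + L) => N; apply: le_trans (lerD (uM N) (vL N)).
  rewrite -big_split /=; apply: ler_sum => j _.
  apply: le_trans (nrm_le_norm1 _ _ _) _; apply: le_trans (norm1M _ _) _.
  rewrite norm1_adj; have := sqr_ge0 (norm1 (u j) - norm1 (v j)).
  have := norm1_ge0 (u j); have := norm1_ge0 (v j); nra.
rewrite /inner (cvgC_lim uz); apply: eq_cvgC uz => N.
by rewrite /series /= big_mkord.
Qed.

Lemma inner_lincombr p c (u v w : nat -> 'cV[C]_p) :
  sqsum u -> sqsum v -> sqsum w ->
  inner u (fun j => c *: v j + w j) = Num.conj c * inner u v + inner u w.
Proof.
move=> su sv sw.
have H1 := inner_cvg su (sqsum_lincomb c sv sw).
have H2 := cvgC_lincomb (c := Num.conj c) (inner_cvg su sv) (inner_cvg su sw).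
apply: (cvgC_unique H1); apply: eq_cvgC H2 => N.
rewrite mulr_sumr -big_split /=; apply: eq_bigr => j _.
by rewrite mxadjD mxadjZ mulmxDl -scalemxAl !mxE.
Qed.

Lemma eq_inner p (u u' v v' : nat -> 'cV[C]_p) :
  u =1 u' -> v =1 v' -> inner u v = inner u' v'.
Proof. by move=> /funext -> /funext ->. Qed.

Lemma inner_push0 p (u v : nat -> 'cV[C]_p) : sqsum u -> sqsum v ->
  inner (push0 u) v = inner u (fun j => v j.+1).
Proof.
move=> su sv; have H1 := (cvgCS _ _).2 (inner_cvg (sqsum_push0 su) sv).
have H2 := inner_cvg su (sqsumS sv).
apply: (cvgC_unique H1); apply: eq_cvgC H2 => N.
by rewrite big_ord_recl /= mulmx0 mxE add0r.
Qed.

(** * Lower triangular Toeplitz operators and their adjoint *)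

Section Toeplitz.
Variables (r m : nat) (P : nat -> 'M[C]_(r, m)).
Hypothesis Pgeo : geo (fun k => norm1 (P k)).

Definition ltoep (u : nat -> 'cV[C]_m) (i : nat) : 'cV[C]_r :=
  \sum_(j < i.+1) P (i - j) *m u j.

(** Boundedness on l2. Up to the constant K, the norms of the image are dominated by the convolution
    s of the norms t of the input with rho^k, and s solves s_{i+1} = rho s_i + t_{i+1}. This yields
    the sum of s^2 bounded by (1 - rho)^{-2} times the sum of t^2. *)
Lemma ltoep_sqsum u : sqsum u -> sqsum (ltoep u).
Proof.
move=> [M uM]; have [K [rho [K0 /andP[r0 r1] PK]]] := Pgeo.
have r1' : 0 < 1 - rho by rewrite subr_gt0.
pose t j := norm1 (u j); pose s i := \sum_(j < i.+1) rho ^+ (i - j) * t j.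
have sS i : s i.+1 = rho * s i + t i.+1.
  rewrite /s big_ord_recr /= subnn expr0 mul1r mulr_sumr; congr (_ + _).
  apply: eq_bigr => j _; rewrite mulrA -exprS subSn //.
  by rewrite -ltnS.
have s0 : s 0%N = t 0%N by rewrite /s big_ord1 subnn expr0 mul1r.
have bS N : \sum_(i < N) s i ^+ 2 <= ((1 - rho) ^+ 2)^-1 * \sum_(i < N) t i ^+ 2.
  elim: N => [|N IH]; first by rewrite !big_ord0 mulr0.
  set T := \sum_(i < N.+1) t i ^+ 2.
  (* Summed from the convexity estimate (rho s + t)^2 <= rho s^2 + t^2 / (1 - rho), whose defect is
     rho / (1 - rho) times a square. *)
  have step : \sum_(i < N.+1) s i ^+ 2 <= rho * \sum_(i < N) s i ^+ 2 + (1 - rho)^-1 * T.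
                                                               
    rewrite /T big_ord_recl [X in _ <= _ + _ * X]big_ord_recl mulrDr s0.
    rewrite addrCA lerD //.
      by rewrite ler_peMl ?sqr_ge0 // invf_ge1 // gerBl ltW.
    rewrite !mulr_sumr -big_split /=; apply: ler_sum => i _; rewrite sS.
    rewrite -subr_ge0 (_ : _ - _ = rho / (1 - rho) *
      ((1 - rho) * s i - t i.+1) ^+ 2).
      by rewrite mulr_ge0 ?sqr_ge0 // divr_ge0 // ltW.
    by field; rewrite gt_eqF.
  apply: (le_trans step).
  have TT : \sum_(i < N) t i ^+ 2 <= T.
    by rewrite /T big_ord_recr /= lerDl sqr_ge0.
  apply: (@le_trans _ _ (rho * (((1 - rho) ^+ 2)^-1 * T) + (1 - rho)^-1 * T)).
    rewrite lerD2r ler_wpM2l ?(ltW r0) //; apply: (le_trans IH).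
    by rewrite ler_wpM2l // invr_ge0 sqr_ge0.
  rewrite le_eqVlt; apply/orP; left; apply/eqP.
  by field; rewrite gt_eqF.
exists (K ^+ 2 * (((1 - rho) ^+ 2)^-1 * M)) => N.
apply: (@le_trans _ _ (\sum_(i < N) K ^+ 2 * s i ^+ 2)); last first.
  rewrite -mulr_sumr ler_wpM2l ?sqr_ge0 //; apply: le_trans (bS N) _.
  by rewrite ler_wpM2l // invr_ge0 sqr_ge0.
apply: ler_sum => i _; rewrite -exprMn.
have le : norm1 (ltoep u i) <= K * s i.
  apply: le_trans (norm1_sum _ _) _; rewrite /s mulr_sumr; apply: ler_sum => j _.
  apply: le_trans (norm1M _ _) _; rewrite mulrA ler_wpM2r ?norm1_ge0 //.
rewrite ler_sqr ?nnegrE ?norm1_ge0 //; exact: le_trans (norm1_ge0 _) le.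
Qed.

Lemma ltoep_push0 u : ltoep (push0 u) =1 push0 (ltoep u).
Proof.
case=> [|i]; first by rewrite /ltoep big_ord1 mulmx0.
by rewrite /ltoep big_ord_recl mulmx0 add0r.
Qed.

(** The adjoint is handled as a relation through its defining identity, so it never has to be
    constructed as an operator. *)
Definition adjeq v y : Prop :=
  l2 v /\ l2 y /\ forall u, l2 u -> inner (ltoep u) v = inner u y.

Lemma adjeq_lincomb c v1 y1 v2 y2 : adjeq v1 y1 -> adjeq v2 y2 ->
  adjeq (fun j => c *: v1 j + v2 j) (fun j => c *: y1 j + y2 j).
Proof.
move=> [/l2P v1s [/l2P y1s a1]] [/l2P v2s [/l2P y2s a2]]; split; last split.
- by apply/l2P; exact: sqsum_lincomb.
- by apply/l2P; exact: sqsum_lincomb.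
move=> u lu; have /l2P us := lu; have Ts := ltoep_sqsum us.
by rewrite !inner_lincombr // a1 // a2.
Qed.

(** The Toeplitz operator commutes with the forward shift; test the adjoint identity on shifted
    sequences. *)
Lemma adjeq_shift v y : adjeq v y ->
  adjeq (fun j => v j.+1) (fun j => y j.+1).
Proof.
move=> [/l2P vs [/l2P ys a]]; split; last split.
- by apply/l2P; exact: sqsumS.
- by apply/l2P; exact: sqsumS.
move=> u lu; have /l2P us := lu; have Ts := ltoep_sqsum us.
rewrite -!inner_push0 // -a; last by apply/l2P; exact: sqsum_push0.
by apply: eq_inner => // i; rewrite ltoep_push0.
Qed.

(** Test the adjoint identity on the b-th basis vector placed at index 0, whose image is column b of
    every P_i. *)
Lemma adjeq_at0 v y b : adjeq v y ->
  ((fun N => \sum_(i < N) (mxadj (v i) *m P i) 0 b) @ \oo --> mxadj (y 0%N) 0 b).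
Proof.
move=> [/l2P vs [/l2P ys a]].
pose u (j : nat) : 'cV[C]_m := if j is _.+1 then 0 else delta_mx b 0.
have us : sqsum u.
  exists (norm1 (u 0%N) ^+ 2) => -[|N]; first by rewrite big_ord0 sqr_ge0.
  by rewrite big_ord_recl /= big1 ?addr0 // => i _; rewrite norm1_0 expr0n.
have Tu i : ltoep u i = P i *m delta_mx b 0.
  by rewrite /ltoep big_ord_recl subn0 /= big1 ?addr0 // => j _; rewrite mulmx0.
have H := inner_cvg (ltoep_sqsum us) vs.
have -> : mxadj (y 0%N) 0 b = inner u y.
  have H2 := inner_cvg us ys; apply: cvgC_unique H2; apply/cvgCS.
  apply: eq_cvgC (cvgC_cst (z := mxadj (y 0%N) 0 b)) => N.
  rewrite big_ord_recl /= big1 ?addr0 => [|i _]; last by rewrite mulmx0 mxE.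
  by rewrite -colE [RHS]mxE.
rewrite -a; last exact/l2P.
apply: eq_cvgC H => N; apply: eq_bigr => i _.
by rewrite Tu mulmxA -colE [LHS]mxE.
Qed.

Lemma exchange_triangle (F : nat -> nat -> C) N :
  \sum_(i < N) \sum_(j < i.+1) F i j =
  \sum_(j < N) \sum_(k < N - j) F (j + k)%N j.
Proof.
elim: N => [|N IH]; first by rewrite !big_ord0.
rewrite big_ord_recr /= IH [in RHS]big_ord_recr /= subSnn big_ord1 addn0.
rewrite [in LHS]big_ord_recr /= addrA; congr (_ + _).
rewrite -big_split /=; apply: eq_bigr => j _.
by rewrite subSn ?(ltnW (ltn_ord j)) // big_ord_recr /= subnKC // ltnW.
Qed.

(** The formal adjoint formula, y_j equal to the sum of P_k^* v_{j+k}, is the true one when v decays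
    geometrically. After exchanging a triangular double sum, the N-th partial inner products differ
    only by the tails beyond N - j of the series for y_j, for j < N. Each is of order rho^N, so the
    total is of order N rho^N. *)
Lemma adjeq_geo v y : geo (fun j => norm1 (v j)) -> l2 y ->
  (forall j b, gcvg (fun N => \sum_(k < N) (mxadj (v (j + k)%N) *m P k) 0 b)
                    (mxadj (y j) 0 b)) ->
  adjeq v y.
Proof.
move=> gv ly vy; have vs := sqsum_geo gv; have /l2P ys := ly.
split; first exact/l2P.
split=> // u /l2P us; have [U U0 uU] := sqsum_bounded us.
have [K [rho [K0 r01 PK vK]]] := geo_common Pgeo gv; have /andP[r0 r1] := r01.
have r1' : 0 < 1 - rho by rewrite subr_gt0.
have H1 := inner_cvg (ltoep_sqsum us) vs; have H2 := inner_cvg us ys.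
pose D N := \sum_(i < N) (mxadj (v i) *m ltoep u i) 0 0 -
            \sum_(j < N) (mxadj (y j) *m u j) 0 0.
suff gD : geo (fun N => nrm (D N)).
  have gD' : gcvg D 0 by apply: geo_le gD => N; rewrite subr0.
  have := cvgCD (gcvg_cvg gD') H2; rewrite add0r.
  by move=> H3; apply: (cvgC_unique H1); apply: eq_cvgC H3 => N; rewrite subrK.
have DE N : D N = \sum_(j < N) \sum_b
    (\sum_(k < N - j) (mxadj (v (j + k)%N) *m P k) 0 b - mxadj (y j) 0 b) * u j b 0.
  rewrite /D (eq_bigr (fun i : 'I_N => \sum_(j < i.+1)
     (mxadj (v i) *m P (i - j)%N *m u j) 0 0)); last first.
    move=> i _; rewrite /ltoep mulmx_sumr summxE.
    by apply: eq_bigr => j _; rewrite mulmxA.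
  rewrite (exchange_triangle (fun i j => (mxadj (v i) *m P (i - j)%N *m u j) 0 0)).
  rewrite -sumrB; apply: eq_bigr => j _.
  rewrite (eq_bigr (fun k : 'I_(N - j) => \sum_b
     (mxadj (v (j + k)%N) *m P k) 0 b * u j b 0)); last first.
    by move=> k _; rewrite addKn mxE.
  rewrite exchange_big /= [X in _ - X]mxE -sumrB; apply: eq_bigr => b _.
  by rewrite mulrBl mulr_suml.
(* The factor rho^j comes from the decay of v_{j+k}; with M = N - j it combines with rho^M to give
   rho^N for every j. *)
have tail (j M : nat) b : nrm (\sum_(k < M) (mxadj (v (j + k)%N) *m P k) 0 b -
    mxadj (y j) 0 b) <= K * rho ^+ j * K / (1 - rho) * rho ^+ M.
  have cK : 0 <= K * rho ^+ j * K by rewrite !mulr_ge0 // exprn_ge0 // ltW.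
  have bk k : nrm ((mxadj (v (j + k)%N) *m P k) 0 b) <= K * rho ^+ j * K * rho ^+ k.
    apply: le_trans (nrm_le_norm1 _ _ _) _.
    apply: le_trans (norm1M _ _) _; rewrite norm1_adj -mulrA.
    apply: ler_pM; rewrite ?norm1_ge0 //; apply: le_trans (vK _) _.
    rewrite ler_wpM2l // exprD ler_piMr ?exprn_ge0 ?(ltW r0) //.
    by rewrite exprn_ile1 // ltW.
  exact: (series_tail cK r01 bk (gcvg_cvg (vy j b))).
have gN : geo (fun N => m%:R * (K * K / (1 - rho)) * U * (N%:R * rho ^+ N)).
  apply: geoZ; first by rewrite !mulr_ge0 // invr_ge0 ltW.
  by apply: geo_natmul; exists 1, rho; split=> // k; rewrite mul1r.
apply: geo_le gN => N; rewrite DE.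
apply: le_trans (nrm_sum _ _ _) _.
apply: (@le_trans _ _ (\sum_(j < N) \sum_(b < m)
   (K * K / (1 - rho) * rho ^+ N * U))); last first.
  rewrite sumr_const card_ord sumr_const card_ord -mulrnA -[leLHS]mulr_natl natrM.
  by rewrite le_eqVlt; apply/orP; left; apply/eqP; ring.
apply: ler_sum => j _; apply: le_trans (nrm_sum _ _ _) _.
apply: ler_sum => b _; rewrite nrmM ler_pM ?nrm_ge0 //; last first.
  exact: le_trans (nrm_le_norm1 _ _ _) (uU j).
apply: le_trans (tail j (N - j)%N b) _.
rewrite -[in leRHS](subnKC (ltnW (ltn_ord j))) exprD.
by rewrite le_eqVlt; apply/orP; left; apply/eqP; ring.
Qed.

Definition ltoep_dense : Prop :=
  forall v : nat -> 'cV[C]_r, l2 v -> forall e : C, 0 < e ->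
  exists u, l2 u /\
    inner (fun j => ltoep u j - v j) (fun j => ltoep u j - v j) < e.

                                                                           
(** The kernel of the adjoint is orthogonal to the range. If w is orthogonal to T u, then |w|^2 <=
    |T u - w|^2, and density makes the right side arbitrarily small. It suffices to bound one entry
    of w at a time. *)
Lemma adjeq_inj0 w : ltoep_dense -> adjeq w (fun=> 0) -> forall j, w j = 0.
Proof.
move=> dense [lw [_ a]] j0; have /l2P ws := lw.
suff w0 : sqnR (w j0) <= 0.
  apply/colP => i; rewrite mxE; apply: nrm_eq0; apply/eqP.
  rewrite -sqrf_eq0 eq_le sqr_ge0 andbT; apply: le_trans w0.
  rewrite /sqnR (bigD1 i) //= lerDl.
  by apply: sumr_ge0 => k _; rewrite exprn_ge0 // nrm_ge0.
apply/ler_addgt0Pr => e e0; rewrite add0r.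
have [|u [lu due]] := dense w lw e%:C%C; first by rewrite (ltcR 0 e).
have /l2P us := lu; have Ts := ltoep_sqsum us.
have ds : sqsum (fun j => ltoep u j - w j).
  have := sqsum_lincomb (-1) ws Ts; congr sqsum; apply/funext => j.
  by rewrite scaleN1r addrC.
have H := cvgC_Re (inner_cvg ds ds).
have H2 := cvgC_Re (inner_cvg Ts ws).
have Tw0 : inner (ltoep u) w = 0.
  have z0 : sqsum (fun=> 0 : 'cV[C]_m).
    by exists 0 => N; rewrite big1 // => i _; rewrite norm1_0 expr0n.
  rewrite a //; apply: (cvgC_unique (inner_cvg us z0)).
  apply: eq_cvgC (cvgC_cst (z := 0)) => N.
  by rewrite big1 // => i _; rewrite mxadj0 mul0mx mxE.
(* Expanding |x - y|^2 and dropping |x|^2; used termwise with x an entry of T u and y an entry of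
   w. *)
have pw (x y : 'cV[C]_r) : sqnR y - 2 * complex.Re ((mxadj y *m x) 0 0) <=
    complex.Re ((mxadj (x - y) *m (x - y)) 0 0).
  rewrite /sqnR !mxE !cRe_sum mulr_sumr -sumrB; apply: ler_sum => i _.
  rewrite !mxE nrm_sqr !cReM !cReJ !cImJ !cReD !cImD !cReN !cImN.
  have := sqr_ge0 (complex.Re (x i 0)); have := sqr_ge0 (complex.Im (x i 0)).
  nra.
move: due; rewrite ltcE /= => /andP[_ due]; apply: le_trans (ltW due).
have H3 : ((fun N => complex.Re (\sum_(j < N)
    (mxadj (ltoep u j - w j) *m (ltoep u j - w j)) 0 0) +
    2 * complex.Re (\sum_(j < N) (mxadj (w j) *m ltoep u j) 0 0)) @ \oo -->
    complex.Re (inner (fun j => ltoep u j - w j) (fun j => ltoep u j - w j)) +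
    2 * complex.Re (inner (ltoep u) w)).
  by apply: cvgD; [exact: H|apply: cvgMr; exact: H2].
move: H3; rewrite Tw0 /= mulr0 addr0 => H3.
rewrite -(cvg_lim _ H3) //; apply: limr_ge; first exact: cvgP H3.
exists j0.+1 => // N /= jN.
rewrite !cRe_sum mulr_sumr -big_split /=.
apply: (@le_trans _ _ (\sum_(j < N) sqnR (w j))).
  rewrite (bigD1 (Ordinal jN)) //= lerDl.
  by apply: sumr_ge0 => k _; exact: sqnR_ge0.
by apply: ler_sum => j _; rewrite -lerBlDr pw.
Qed.

Lemma adjeq_inj v v' y : ltoep_dense -> adjeq v y -> adjeq v' y -> v =1 v'.
Proof.
move=> dense av av' j; have H := adjeq_lincomb (-1) av av'.
have {}H : adjeq (fun j => -1 *: v j + v' j) (fun=> 0).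
  move: H; congr adjeq; apply/funext => k.
  by rewrite scaleN1r addNr.
have := adjeq_inj0 dense H j; rewrite scaleN1r addrC => /eqP.
by rewrite subr_eq0 => /eqP.
Qed.

End Toeplitz.
End SquareSummable.

(** * Fourier coefficients of [Phi] and of R *)

Section FourierCoefficients.
Variable R : realType.
Local Notation C := R[i].

Lemma fourier_mean r m (Om : C -> 'M[C]_(r, m)) k i j :
  fourier Om k i j = mean (fun t => Om (expi t) i j * expi (- (k%:~R * t))).
Proof. by rewrite mxE. Qed.

Lemma RHinf_fourier r m (Phi : C -> 'M[C]_(r, m)) : RHinf Phi ->
  (forall i j, ana (fun z => Phi z i j) (fun k => fourier Phi k%:Z i j)) /\
  (forall k, fourier Phi (Negz k) = 0).
Proof.
move=> [N [d [d0 PhiE]]].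
have H i j : exists a, ana (fun z => Phi z i j) a.
  have [|a fa] := @ana_rational R (N i j) d.
    by move=> z z1; apply: d0; rewrite -nrm_le1.
  exists a; apply: eq_ana fa => z z1.
  by rewrite PhiE -?nrm_le1 // !mxE.
split=> [i j|k].
  have [a fa] := H i j.
  have -> : (fun k => fourier Phi (Posz k) i j) = a.
    by apply/funext => k; rewrite fourier_mean (mean_ana k%:Z fa).
  exact: fa.
apply/matrixP => i j; have [a fa] := H i j.
by rewrite fourier_mean (mean_ana (Negz k) fa) mxE.
Qed.

(** Negative Fourier coefficients vanish, so the series defining entry i of the Toeplitz image is
    constant after i + 1 terms. *)
Lemma toepE r m (Phi : C -> 'M[C]_(r, m)) : RHinf Phi ->
  toep Phi = ltoep (fun k => fourier Phi k%:Z).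
Proof.
move=> /RHinf_fourier[_ neg]; apply/funext => u; apply/funext => i.
apply/colP => a; rewrite mxE; apply: cvgC_lim; apply: gcvg_cvg.
apply: (@gcvg_eventually _ i.+1) => N iN.
rewrite /series /= (big_cat_nat (n := i.+1)) //= [X in _ + X]big_nat_cond.
rewrite [X in _ + X]big1 ?addr0 => [|j /andP[/andP[ij _] _]].
  rewrite big_mkord /ltoep summxE; apply: eq_bigr => j _.
  by rewrite subzn // -ltnS.
have -> : i%:Z - j%:Z = Negz (j - i.+1)%N by lia.
by rewrite neg mul0mx mxE.
Qed.

(** On the circle 1/z is the conjugate of z, so z - A^* is z times the adjoint of 1 - zA; the last
    term of R is then the adjoint of the first. *)
Lemma Rfun_circle m n (Cm : 'M[C]_(m, n)) A G R0 z : stable A -> nrm z = 1 ->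
  Rfun Cm A G R0 z = z *: (Cm *m invmx (1%:M - z *: A) *m G) + R0 +
    mxadj (z *: (Cm *m invmx (1%:M - z *: A) *m G)).
Proof.
move=> sA z1; rewrite /Rfun; congr (_ + _); set M := 1%:M - z *: A.
have uM : M \in unitmx by apply: stable_unitmx => //; rewrite z1.
have zz : z * Num.conj z = 1 by rewrite -normCK nrmE z1 expr1n.
have E : (z%:M - mxadj A) *m (Num.conj z *: mxadj (invmx M)) = 1%:M.
  have -> : z%:M - mxadj A = z *: mxadj M.
    apply/matrixP => i j; rewrite !mxE rmorphB rmorphM /= mulrBr mulrA zz mul1r.
    by rewrite eq_sym; congr (_ - _); case: (_ == _);
      rewrite ?mulr1n ?mulr0n ?rmorph1 ?rmorph0 ?mulr1 ?mulr0.
  rewrite -scalemxAl -scalemxAr scalerA zz scale1r -mxadjM mulVmx //.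
  by rewrite /mxadj trmx1 map_mx1.
have [uZ _] := mulmx1_unit E.
have -> : invmx (z%:M - mxadj A) = Num.conj z *: mxadj (invmx M).
  by rewrite -[RHS]mul1mx -(mulVmx uZ) -mulmxA E mulmx1.
by rewrite mxadjZ !mxadjM -scalemxAr -scalemxAl mulmxA.
Qed.

(** The j-th Fourier coefficient of both sides of R = Phi^* Phi. The right side is computed by
    [mean_conjM_ana]; on the left, R = h + R_0 + h^* with h analytic and h(0) = 0, so h^* does not
    contribute for j >= 0. *)
Lemma spectral_factor_coef m n r (Cm : 'M[C]_(m, n)) A G R0
    (Phi : C -> 'M[C]_(r, m)) : stable A -> RHinf Phi ->
  (forall z, `|z| = 1 -> Rfun Cm A G R0 z = mxadj (Phi z) *m Phi z) ->
  forall j a b, gcvg (fun N => \sum_(k < N)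
      (mxadj (fourier Phi k%:Z) *m fourier Phi (k + j)%N%:Z) a b)
    (if j is j'.+1 then (Cm *m A ^+ j' *m G) a b else R0 a b).
Proof.
move=> sA /RHinf_fourier[anaP _] fac j a b.
pose e t : C := expi (- (j%:R * t)).
have ce : ccont e.
  by rewrite /e; under eq_fun do rewrite -mulNr; exact: ccont_expi.
have H c := mean_conjM_ana j (anaP c a) (anaP c b).
have {}H := gcvg_sum (index_enum 'I_r) H.
have cPhi c d : ccont (fun t => Phi (expi t) c d) := ana_ccont (anaP c d).
pose hz z := z *: (Cm *m invmx (1%:M - z *: A) *m G).
have anaH c d : ana (fun z => hz z c d)
    (fun k => if k is k'.+1 then (Cm *m A ^+ k' *m G) c d else 0).
  by apply: eq_ana (ana_mulX (ana_realization Cm G sA c d)) => z _; rewrite [RHS]mxE.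
have cH c d : ccont (fun t => hz (expi t) c d) := ana_ccont (anaH c d).
have E : \sum_c mean (fun t => Num.conj (Phi (expi t) c a) * Phi (expi t) c b * e t)
    = if j is j'.+1 then (Cm *m A ^+ j' *m G) a b else R0 a b.
  rewrite -mean_sum; last first.
    by move=> c; apply: ccontM => //; apply: ccontM => //; exact: ccont_conj.
  have Et t : \sum_c Num.conj (Phi (expi t) c a) * Phi (expi t) c b * e t =
      (hz (expi t) a b * e t + R0 a b * e t) +
      Num.conj (hz (expi t) b a * Num.conj (e t)).
    have t1 : nrm (expi t : C) = 1 by exact: nrm_expi.
    rewrite -mulr_suml rmorphM /= conjCK -!mulrDl; congr (_ * _).
    have := fac (expi t); rewrite nrmE t1 => /(_ erefl).
    rewrite Rfun_circle // => /matrixP/(_ a b); rewrite !mxE => -> .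
    by apply: eq_bigr => c _; rewrite mxadjE.
  rewrite (eq_mean Et) meanD; last first.
  - by apply/ccont_conj/ccontM => //; exact: ccont_conj.
  - by apply: ccontD; apply: ccontM => //; exact: ccont_cst.
  rewrite meanD; last first.
  - by apply: ccontM => //; exact: ccont_cst.
  - exact: ccontM.
  rewrite (mean_ana j%:Z (anaH a b)) meanZ //.
  rewrite mean_conj; last by apply: ccontM => //; exact: ccont_conj.
  (* This is the coefficient of h of index -j: zero for j > 0 by analyticity, and for j = 0 because
     h(0) = 0. *)
  have -> : mean (fun t => hz (expi t) b a * Num.conj (e t)) = 0.
    have := mean_ana (- j%:Z) (anaH b a).
    rewrite (@eq_mean _ _ (fun t => hz (expi t) b a * Num.conj (e t))).
      by move=> ->; case: j {e ce H Et}.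
    move=> t; congr (_ * _); rewrite /e conj_expi; congr expi.
    by rewrite mulrNz; ring.
  have -> : mean e = (j == 0)%:R.
    have := mean_expi R (- j%:Z); rewrite oppr_eq0 => <-.
    by apply: eq_mean => t; rewrite /e mulrNz mulNr.
  rewrite rmorph0 addr0; case: j {e ce H Et} => [|j] /=.
    by rewrite mulr1 add0r.
  by rewrite mulr0 addr0.
rewrite -E; apply: eq_gcvg H => N.
rewrite exchange_big /=; apply: eq_bigr => k _.
by rewrite mxE; apply: eq_bigr => c _; rewrite mxadjE.
Qed.

End FourierCoefficients.

(** * Extending a single-valued linear relation to a matrix *)

Section LinearRelations.
Variable F : fieldType.

(** Take U of maximal rank among matrices whose row space lies in Q. Adjoining any s in Q stays
    inside Q, so by maximality s already lies in the row space of U. *)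
Lemma subspace_rowspace N (Q : 'rV[F]_N -> Prop) : Q 0 ->
  (forall c s t, Q s -> Q t -> Q (c *: s + t)) ->
  exists U : 'M[F]_N, forall s, Q s <-> (s <= U)%MS.
Proof.
move=> Q0 Qlin.
pose inQ (U : 'M[F]_N) := forall s : 'rV[F]_N, (s <= U)%MS -> Q s.
pose rk k := `[< exists2 U, inQ U & \rank U = k >].
have ex : exists k, rk k.
  exists 0%N; apply/asboolP; exists 0; last exact: mxrank0.
  by move=> s; rewrite submx0 => /eqP ->.
have ub k : rk k -> (k <= N)%N by move=> /asboolP[U _ <-]; exact: rank_leq_row.
case: (ex_maxnP ex ub) => k /asboolP[U UQ Uk] max.
exists U => s; split=> [Qs|]; last exact: UQ.
have UsQ : inQ (U + s)%MS.
  move=> t /sub_addsmxP[[a b] /= ->].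
  have [c ->] : exists c, b *m s = c *: s.
    by exists (b 0 0); rewrite {1}[b]mx11_scalar mul_scalar_mx.
  by rewrite addrC; apply: Qlin => //; apply: UQ; exact: submxMl.
have le : (\rank (U + s)%MS <= \rank U)%N.
  by rewrite Uk; apply: max; apply/asboolP; exists (U + s)%MS.
apply: submx_trans (addsmxSr U s) _.
by rewrite -(mxrank_leqif_sup (addsmxSl U s)) eqn_leq mxrankS ?addsmxSl.
Qed.

Lemma linear_relation_graph n r (Rel : 'cV[F]_n -> 'cV[F]_r -> Prop) :
  Rel 0 0 ->
  (forall c x w x' w', Rel x w -> Rel x' w' -> Rel (c *: x + x') (c *: w + w')) ->
  (forall w, Rel 0 w -> w = 0) ->
  exists M : 'M[F]_(r, n), forall x w, Rel x w -> w = M *m x.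
Proof.
move=> R0 Rlin Rfun.
pose Q (s : 'rV[F]_(n + r)) := Rel (lsubmx s)^T (rsubmx s)^T.
have [||U QU] := @subspace_rowspace _ Q.
- by rewrite /Q !linear0.
- by move=> c s t Qs Qt; rewrite /Q !linearP; exact: Rlin.
pose U1 := lsubmx U; pose U2 := rsubmx U.
exists (pinvmx U1 *m U2)^T => x w Rxw.
have /QU/submxP[a aU] : Q (row_mx x^T w^T).
  by rewrite /Q row_mxKl row_mxKr !trmxK.
have aU1 : x^T = a *m U1.
  by rewrite -[U]hsubmxK mul_mx_row in aU; case/eq_row_mx: aU.
have aU2 : w^T = a *m U2.
  by rewrite -[U]hsubmxK mul_mx_row in aU; case/eq_row_mx: aU.
(* The pseudo-inverse may return other coefficients than a for the same x. The difference b gives a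
   pair (0, b U2) in the relation, so single-valuedness forces b U2 = 0. *)
pose b := a *m U1 *m pinvmx U1 - a.
have bU1 : b *m U1 = 0 by rewrite mulmxBl mulmxKpV ?submxMl ?subrr.
have bU2 : b *m U2 = 0.
  have : Q (b *m U) by apply/QU; exact: submxMl.
  rewrite /Q -{1 2}[U]hsubmxK mul_mx_row row_mxKl row_mxKr -/U1 -/U2 bU1 trmx0.
  by move/Rfun => /(congr1 trmx); rewrite trmxK trmx0.
apply: trmx_inj; rewrite trmx_mul trmxK aU1 aU2 [RHS]mulmxA.
by move/eqP: bU2; rewrite mulmxBl subr_eq0 => /eqP ->.
Qed.

End LinearRelations.

(** * Entrywise geometric limits of matrices and the observability Gramian *)

Section MatrixLimits.
Variable R : realType.
Local Notation C := R[i].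

Definition mxgcvg p q (S : nat -> 'M[C]_(p, q)) (L : 'M[C]_(p, q)) : Prop :=
  forall i j, gcvg (fun N => S N i j) (L i j).

Lemma eq_mxgcvg p q (S S' : nat -> 'M[C]_(p, q)) L :
  S =1 S' -> mxgcvg S L -> mxgcvg S' L.
Proof. by move=> /funext ->. Qed.

Lemma mxgcvg_unique p q (S : nat -> 'M[C]_(p, q)) L L' :
  mxgcvg S L -> mxgcvg S L' -> L = L'.
Proof.
move=> SL SL'; apply/matrixP => i j.
exact: gcvg_unique (SL i j) (SL' i j).
Qed.

Lemma mxgcvgD p q (S S' : nat -> 'M[C]_(p, q)) L L' :
  mxgcvg S L -> mxgcvg S' L' -> mxgcvg (fun N => S N + S' N) (L + L').
Proof.
move=> SL SL' i j; rewrite mxE.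
by apply: eq_gcvg (gcvgD (SL i j) (SL' i j)) => N; rewrite mxE.
Qed.

Lemma mxgcvg_cst p q (L : 'M[C]_(p, q)) : mxgcvg (fun=> L) L.
Proof. by move=> i j; exact: gcvg_cst. Qed.

Lemma mxgcvg_mull p q l (M : 'M[C]_(p, q)) (S : nat -> 'M[C]_(q, l)) L :
  mxgcvg S L -> mxgcvg (fun N => M *m S N) (M *m L).
Proof.
move=> SL i j; rewrite mxE.
apply: eq_gcvg (gcvg_sum (index_enum 'I_q) (fun k => gcvgZ (M i k) (SL k j))) => N.
by rewrite mxE.
Qed.

Lemma mxgcvg_mulr p q l (M : 'M[C]_(q, l)) (S : nat -> 'M[C]_(p, q)) L :
  mxgcvg S L -> mxgcvg (fun N => S N *m M) (L *m M).
Proof.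
move=> SL i j; rewrite mxE.
under eq_bigr do rewrite mulrC.
apply: eq_gcvg (gcvg_sum (index_enum 'I_q) (fun k => gcvgZ (M k j) (SL i k))) => N.
by rewrite mxE; apply: eq_bigr => k _; rewrite mulrC.
Qed.

Lemma mxgcvg_adj p q (S : nat -> 'M[C]_(p, q)) L :
  mxgcvg S L -> mxgcvg (fun N => mxadj (S N)) (mxadj L).
Proof.
move=> SL i j; rewrite mxadjE.
by apply: eq_gcvg (gcvg_conj (SL j i)) => N; rewrite mxadjE.
Qed.

Lemma mxgcvgS p q (S : nat -> 'M[C]_(p, q)) L :
  mxgcvg (fun N => S N.+1) L <-> mxgcvg S L.
Proof.
by split=> SL i j; [exact: gcvg_unshift (SL i j)|exact: gcvgS (SL i j)].
Qed.

Lemma gramian_cvg p n (B : 'M[C]_(p, n)) (A : 'M[C]_n) : stable A ->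
  mxgcvg (fun N => \sum_(k < N) mxadj (A ^+ k) *m mxadj B *m B *m A ^+ k)
    (gramian B A).
Proof.
move=> sA i j; have gA := geo_norm1 (stable_geo sA).
have [M M0 AM] := geo_bounded gA.
have g : geo (fun k => nrm ((mxadj (A ^+ k) *m mxadj B *m B *m A ^+ k) i j)).
  apply: geo_le (geoZ (_ : 0 <= M * norm1 B * norm1 B) gA) => [k|]; last first.
    by rewrite !mulr_ge0 ?norm1_ge0.
  apply: le_trans (nrm_le_norm1 _ _ _) _; apply: le_trans (norm1M _ _) _.
  rewrite ler_wpM2r ?norm1_ge0 //; apply: le_trans (norm1M _ _) _.
  rewrite ler_wpM2r ?norm1_ge0 //; apply: le_trans (norm1M _ _) _.
  by rewrite !norm1_adj ler_wpM2r ?norm1_ge0.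
have [z gz] := geo_series g.
have -> : gramian B A i j = z.
  rewrite mxE; apply: cvgC_lim; apply: eq_cvgC (gcvg_cvg gz) => N.
  by rewrite /series /= big_mkord.
by apply: eq_gcvg gz => N; rewrite summxE.
Qed.

Lemma gramian_adj p n (B : 'M[C]_(p, n)) (A : 'M[C]_n) : stable A ->
  mxadj (gramian B A) = gramian B A.
Proof.
move=> sA; apply: mxgcvg_unique (gramian_cvg B sA).
apply: eq_mxgcvg (mxgcvg_adj (gramian_cvg B sA)) => N.
elim: N => [|N IH]; first by rewrite !big_ord0 mxadj0.
by rewrite !big_ord_recr /= mxadjD IH !mxadjM !mxadjK !mulmxA.
Qed.

End MatrixLimits.

(** * The space X_Phi, the matrix C_Phi and the Gramian identities *)

Section OuterFactor.
Variables (R : realType) (m n r : nat).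
Local Notation C := R[i].
Variables (Cm : 'M[C]_(m, n)) (A : 'M[C]_n) (G : 'M[C]_(n, m)) (R0 : 'M[C]_m).
Variable P : nat -> 'M[C]_(r, m).
Hypothesis sA : stable A.
Hypothesis Pgeo : geo (fun k => norm1 (P k)).
Hypothesis dense : ltoep_dense P.
(** R = Phi^* Phi in terms of Fourier coefficients, the only form in which the factorization enters
    this part. *)
Hypothesis PP : forall j, mxgcvg (fun N => \sum_(k < N) mxadj (P k) *m P (k + j)%N)
  (if j is j'.+1 then Cm *m A ^+ j' *m G else R0).

Lemma Wobs_lincomb p (B : 'M[C]_(p, n)) c x y :
  Wobs B A (c *: x + y) = (fun j => c *: Wobs B A x j + Wobs B A y j).
Proof. by apply/funext => j; rewrite /Wobs mulmxDr -scalemxAr. Qed.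

Lemma Wobs_shift p (B : 'M[C]_(p, n)) x :
  Wobs B A (A *m x) = (fun j => Wobs B A x j.+1).
Proof. by apply/funext => j; rewrite /Wobs exprSr -mulmxE !mulmxA. Qed.

Lemma Wobs_sqsum p (B : 'M[C]_(p, n)) x : sqsum (Wobs B A x).
Proof.
apply: sqsum_geo; have gA := geo_norm1 (stable_geo sA).
apply: geo_le (geoZ (norm1_ge0 B) (geoZr (norm1_ge0 x) gA)) => k.
by rewrite /Wobs -mulmxA (le_trans (norm1M _ _)) // ler_wpM2l ?norm1_ge0 // norm1M.
Qed.

(** Entry j of the formal adjoint applied to this sequence is the sum of P_k^* P_{k+j+1} e, which
    equals C A^j Gamma e by [PP]; [adjeq_geo] makes this rigorous. *)
Lemma adjeq_Gamma (e : 'cV[C]_m) :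
  adjeq P (fun i => P i.+1 *m e) (Wobs Cm A (G *m e)).
Proof.
apply: adjeq_geo => //.
- by apply: geo_le (geoZr (norm1_ge0 e) (geoS Pgeo)) => k; exact: norm1M.
- by apply/l2P; exact: Wobs_sqsum.
move=> j b.
have H := mxgcvg_adj (mxgcvg_mulr e (PP j.+1)) 0 b.
rewrite /Wobs mulmxA; apply: eq_gcvg H => N.
rewrite mulmx_suml mxadj_sum summxE; apply: eq_bigr => k _.
by rewrite !mxadjM mxadjK mulmxA addnS addnC.
Qed.

Definition Xsp (x : 'cV[C]_n) : Prop := exists v, adjeq P v (Wobs Cm A x).

Lemma Xsp_lincomb c x y : Xsp x -> Xsp y -> Xsp (c *: x + y).
Proof.
move=> [v av] [w aw]; exists (fun j => c *: v j + w j).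
by rewrite Wobs_lincomb; exact: adjeq_lincomb.
Qed.

Lemma Xsp_shift x : Xsp x -> Xsp (A *m x).
Proof.
by move=> [v av]; exists (fun j => v j.+1); rewrite Wobs_shift; exact: adjeq_shift.
Qed.

Lemma Xsp_krylov x : krylov A G x -> Xsp x.
Proof.
move=> [N [ys ->]].
have XG k e : Xsp (A ^+ k *m G *m e).
  elim: k => [|k IH].
    by rewrite expr0 mul1mx; exists (fun i => P i.+1 *m e); exact: adjeq_Gamma.
  by rewrite exprS -mulmxE -!mulmxA; apply: Xsp_shift; rewrite mulmxA.
apply: (big_ind Xsp) => [|x' y' X1 X2|k _]; last exact: XG.
- by have := XG 0%N 0; rewrite mulmx0.
- by rewrite -[x']scale1r; exact: Xsp_lincomb.
Qed.

(** By injectivity the initial entry of the preimage of W_obs x is a single-valued linear function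
    of x, hence given by a matrix B. The j-fold backward shift of v is the preimage for A^j x, so
    its initial entry v_j is B A^j x. *)
Lemma observation_matrix : exists B : 'M[C]_(r, n),
  forall x v, adjeq P v (Wobs Cm A x) -> v = Wobs B A x.
Proof.
pose Rel x w := exists2 v, adjeq P v (Wobs Cm A x) & v 0%N = w.
have [| | |B RelB] := @linear_relation_graph _ n r Rel.
- exists (fun i => P i.+1 *m 0); last by rewrite mulmx0.
  by have := adjeq_Gamma 0; rewrite mulmx0.
- move=> c x w x' w' [v av <-] [v' av' <-].
  exists (fun j => c *: v j + v' j); last exact: erefl.
  by rewrite Wobs_lincomb; exact: adjeq_lincomb.
- move=> w [v av <-]; have a0 := adjeq_Gamma 0.
  rewrite mulmx0 in a0; have /(_ 0%N) := adjeq_inj Pgeo dense av a0.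
  by rewrite mulmx0.
exists B => x v av; apply/funext => j.
elim: j x v av => [|j IH] x v av.
  by rewrite /Wobs expr0 mulmx1; apply: RelB; exists v.
have as1 := adjeq_shift Pgeo av; rewrite -Wobs_shift in as1.
by rewrite (IH _ _ as1) Wobs_shift.
Qed.

Section Realization.
Variable B : 'M[C]_(r, n).
Hypothesis adjB : forall x v, adjeq P v (Wobs Cm A x) -> v = Wobs B A x.

(** Apply [adjB] to the explicit preimage of W_obs Gamma e for each basis vector e. *)
Lemma factor_coefE k : P k.+1 = B *m A ^+ k *m G.
Proof.
apply/matrixP => i j.
have /(congr1 (fun v : nat -> 'cV[C]_r => v k i 0)) := adjB (adjeq_Gamma (delta_mx j 0)).
by rewrite /Wobs mulmxA -!colE !mxE.
Qed.

(** Split off the term k = 0 in the coefficient identity for j = 0; by [factor_coefE] the rest sums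
    to Gamma^* Q Gamma. *)
Lemma gramian_Phi0 : mxadj (P 0%N) *m P 0%N = R0 - mxadj G *m gramian B A *m G.
Proof.
apply/eqP; rewrite eq_sym subr_eq; apply/eqP.
apply: (mxgcvg_unique (PP 0)); apply/mxgcvgS.
have H := mxgcvgD (mxgcvg_cst (mxadj (P 0%N) *m P 0%N))
  (mxgcvg_mulr G (mxgcvg_mull (mxadj G) (gramian_cvg B sA))).
apply: eq_mxgcvg H => N; rewrite big_ord_recl; congr (_ + _).
rewrite mulmx_sumr mulmx_suml; apply: eq_bigr => k _.
by rewrite addn0 /= factor_coefE !mxadjM !mulmxA.
Qed.

(** Entry 0 of the adjoint identity for v = W_{B,obs} x, with the term i = 0 split off and the
    remaining P_i replaced by [factor_coefE]. *)
Lemma gramian_obs x : Xsp x ->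
  mxadj (P 0%N) *m B *m x = Cm *m x - mxadj G *m gramian B A *m A *m x.
Proof.
move=> [v av]; have vE := adjB av; rewrite vE in av.
(* The identity is proved in adjoint form, since [adjeq_at0] delivers the adjoint of entry 0; taking
   adjoints back uses that the Gramian is Hermitian. *)
suff E : mxadj (Cm *m x) = mxadj (B *m x) *m P 0%N +
    mxadj (A *m x) *m gramian B A *m G.
  have := congr1 (@mxadj R _ _) E; rewrite mxadjK mxadjD !mxadjM !mxadjK.
  by rewrite (gramian_adj B sA) !mulmxA => ->; rewrite addrK.
apply/matrixP => i b; rewrite ord1.
have H1 := adjeq_at0 Pgeo (b := b) av.
have -> : mxadj (Cm *m x) = mxadj (Wobs Cm A x 0%N) by rewrite /Wobs mulmx1.
apply: (cvgC_unique H1); apply: gcvg_cvg; apply: gcvg_unshift.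
have H2 := mxgcvgD (mxgcvg_cst (mxadj (B *m x) *m P 0%N))
  (mxgcvg_mulr G (mxgcvg_mull (mxadj (A *m x)) (gramian_cvg B sA))).
apply: eq_gcvg (H2 0 b) => N; rewrite big_ord_recl mxE.
rewrite {1}/Wobs expr0 mulmx1; congr (_ + _).
rewrite mulmx_sumr mulmx_suml summxE; apply: eq_bigr => k _.
by rewrite /= factor_coefE /Wobs exprSr -mulmxE !mxadjM !mulmxA.
Qed.

End Realization.
End OuterFactor.

Lemma psd_gram (R : realType) p m (M : 'M[R[i]]_(p, m)) : psd (mxadj M *m M).
Proof.
move=> x; rewrite !mulmxA -mxadjM -mulmxA mxE; apply: sumr_ge0 => i _.
by rewrite mxadjE mulrC mul_conjC_ge0.
Qed.

Theorem theorem2p1 (R : realType) (m n r : nat)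
  (Cm : 'M[R[i]]_(m, n)) (A : 'M[R[i]]_n) (G : 'M[R[i]]_(n, m)) (R0 : 'M[R[i]]_m)
  (Phi : R[i] -> 'M[R[i]]_(r, m)) :
  stable A ->
  (exists z : R[i], Rfun_defined A z /\ Rfun Cm A G R0 z != 0) ->
  (forall zeta : R[i], `|zeta| = 1 -> psd (Rfun Cm A G R0 zeta)) ->
  outer_spectral_factor Cm A G R0 Phi ->
  (forall x, XPhi Cm A Phi x -> XPhi Cm A Phi (A *m x)) /\
  (forall x, krylov A G x -> XPhi Cm A Phi x) /\
  exists CPhi : 'M[R[i]]_(r, n),
    [/\ forall z : R[i], `|z| <= 1 ->
          Phi z = Phi 0 + z *: (CPhi *m invmx (1%:M - z *: A) *m G),
        forall x, XPhi Cm A Phi x -> toep_adj_eq Phi (Wobs CPhi A x) (Wobs Cm A x),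
        forall C' : 'M[R[i]]_(r, n),
          (forall x, XPhi Cm A Phi x -> toep_adj_eq Phi (Wobs C' A x) (Wobs Cm A x)) ->
          forall x, XPhi Cm A Phi x -> C' *m x = CPhi *m x,
        forall x, XPhi Cm A Phi x ->
          mxadj (Phi 0) *m CPhi *m x = Cm *m x - mxadj G *m gramian CPhi A *m A *m x
      & mxadj (Phi 0) *m Phi 0 = R0 - mxadj G *m gramian CPhi A *m G]
    /\ psd (R0 - mxadj G *m gramian CPhi A *m G).
Proof.
move=> sA _ _ [_ RH fac dense0].
have [anaP _] := RHinf_fourier RH; pose P k := fourier Phi (Posz k).
have Pgeo : geo (fun k => norm1 (P k)).
  by apply: geo_norm1 => i j; exact: ana_coef_geo (anaP i j).
have TE : toep Phi = ltoep P := toepE RH.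
have dense : ltoep_dense P by rewrite /ltoep_dense -TE.
have adjE v y : toep_adj_eq Phi v y = adjeq P v y by rewrite /toep_adj_eq TE.
have XE x : XPhi Cm A Phi x = Xsp Cm A P x.
  by rewrite /XPhi /in_range_toep_adj /Xsp; congr ex; apply/funext => v; exact: adjE.
have PP j : mxgcvg (fun N => \sum_(k < N) mxadj (P k) *m P (k + j)%N)
    (if j is j'.+1 then Cm *m A ^+ j' *m G else R0).
  move=> a b; have := spectral_factor_coef sA RH fac j a b.
  rewrite (_ : (if j is j'.+1 then (Cm *m A ^+ j' *m G) a b else R0 a b) =
    (if j is j'.+1 then Cm *m A ^+ j' *m G else R0) a b); last by case: j.
  by apply: eq_gcvg => N; rewrite summxE.
have Phi0 : Phi 0 = P 0%N by apply/matrixP => i j; rewrite (ana_at0 (anaP i j)).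
have [B adjB] := observation_matrix sA Pgeo dense PP.
have XB x : Xsp Cm A P x -> adjeq P (Wobs B A x) (Wobs Cm A x).
  by move=> [v av]; rewrite -(adjB _ _ av).
split; first by move=> x; rewrite !XE; exact: Xsp_shift.
split; first by move=> x; rewrite XE; exact: (Xsp_krylov sA Pgeo PP).
exists B; split; last first.
  by rewrite -(gramian_Phi0 sA Pgeo PP adjB); exact: psd_gram.
split.
- move=> z; rewrite -nrm_le1 => z1; apply/matrixP => i j.
  rewrite 2!mxE.
  (* P_0 + z B (1 - zA)^{-1} Gamma has the same power series coefficients as [Phi], so the two agree
     on the closed disc by [ana_unique]. *)
  have H := anaD (anaZ (P 0%N i j) (ana1 R)) (ana_mulX (ana_realization B G sA i j)).
  have E : (fun k => fourier Phi (Posz k) i j) = (fun k => P 0%N i j * (k == 0)%:R +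
      (if k is k'.+1 then (B *m A ^+ k' *m G) i j else 0)).
    apply/funext => -[|k]; first by rewrite mulr1 addr0.
    by rewrite mulr0 add0r -(factor_coefE sA Pgeo PP adjB).
  rewrite -E in H; rewrite (ana_unique (anaP i j) H z1) /= mulr1.
  by rewrite Phi0.
- by move=> x; rewrite XE adjE; exact: XB.
- move=> C' C'adj x Xx; have := C'adj x Xx; rewrite adjE => aC'.
  have /(congr1 (fun v : nat -> 'cV[R[i]]_r => v 0%N)) := adjB _ _ aC'.
  by rewrite /Wobs expr0 !mulmx1.
- by move=> x; rewrite XE Phi0; exact: (gramian_obs sA Pgeo PP adjB).
- by rewrite Phi0; exact: (gramian_Phi0 sA Pgeo PP adjB).
Qed.
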